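(* Suppose all the assumptions on the problem, the set $\mathcal{X}$, the Lagrange multiplier $\mu$, the oracles and the initial point listed in the context hold, and let $x^*\in\mathcal{X}^*$. Let $\bar{x}_T$ be the output of the algorithm described in the context. (1) If $\epsilon>0$, $\eta=\epsilon$, $\alpha=\beta=1/\epsilon$, then $\mathbb{E}\{\|[h(\bar{x}_T)]_+\|_2\}\le\mathcal{O}(\epsilon)$ for all integers $T\ge 1/\epsilon^2$, where the constant hidden in $\mathcal{O}$ does not depend on $\epsilon$ or $T$. (2) If $L,G,D>0$, $T\in\{1,2,3,\ldots\}$, $\alpha=\frac{L\sqrt{T}}{D}$, $\eta=\frac{L}{\sqrt{T(D^2+2\delta)}}$, $\beta=\frac{\sqrt{T}}{GD}$, then $$\mathbb{E}\{\|[h(\bar{x}_T)]_+\|_2\}\le\frac{1}{\sqrt{T}}\sqrt{A_0+A_1\|\mu\|_2+A_2\|\mu\|_2^2},$$ where $$A_2=55\frac{G^3}{L}D\sqrt{D^2+2\delta}+83G^2D^2+8\frac{G^4}{L^2}(D^2+2\delta),$$ $$A_1=16\frac{G^3}{L}(D^2+2\delta)+47G^2D\sqrt{D^2+2\delta},$$ $$\begin{aligned}A_0={}&47GLD^2+47GLD\sqrt{D^2+2\delta}+47G^2D^2+12G^2(D^2+2\delta)\\&+8G^2D\sqrt{D^2+2\delta}+8\frac{G^3}{L}D\sqrt{D^2+2\delta}+\|h(x^* )\|_2^2\left(47+8\frac{G}{L}\frac{\sqrt{D^2+2\delta}}{D}\right).\end{aligned}$$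
   Context: **Problem.** $\mathbb{V}$ is a finite-dimensional real inner product space with inner product $\langle\cdot,\cdot\rangle$ and norm $\|v\|=\sqrt{\langle v,v\rangle}$; $\|\cdot\|_2$ is the Euclidean norm on $\mathbb{R}^m$. $m$ is a nonnegative integer. $f:\mathbb{V}\to\mathbb{R}$ and $h_i:\mathbb{V}\to\mathbb{R}$ ($i=1,\ldots,m$) are convex continuous functions and $h=(h_1,\ldots,h_m)^\top$. The problem is to minimize $f(x)$ subject to $h_i(x)\le 0$ for all $i$ and $x\in\mathcal{X}$, where $\mathcal{X}\subseteq\mathbb{V}$. The set $\mathcal{X}^*\subseteq\mathcal{X}$ of optimal solutions is nonempty and $f^*$ is the optimal value. $[a]_+=\max\{0,a\}$, applied entrywise to vectors. $\partial$ denotes the subdifferential. **Assumptions.** 1. $\mathcal{X}$ is compact and convex, and $D$ is a known constant with $\|x-y\|\le D$ for all $x,y\in\mathcal{X}$. 2. There is a vector (Lagrange multiplier) $\mu\in\mathbb{R}^m$ with nonnegative entries such that $f^*\le f(x)+\mu^\top h(x)$ for all $x\in\mathcal{X}$. 3. The following oracles are available. (i) Inexact linear minimization oracle: given $v\in\mathbb{V}$ and $\delta\ge 0$, it returns a random point $x=\mathrm{InLMO}_{\mathcal{X}}\{v;\delta\}\in\mathcal{X}$ with $\mathbb{E}\{\langle x,v\rangle\}\le\langle y,v\rangle+\delta$ for all $y\in\mathcal{X}$ (for a random query $v$, the expectation is conditional on $v$). (ii) Projection oracle: there is a closed convex set $\mathcal{Y}\subseteq\mathbb{V}$ with $\mathcal{X}\subseteq\mathcal{Y}$;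 given $v\in\mathbb{V}$ it returns $\mathrm{PO}_{\mathcal{Y}}\{v\}=\arg\min_{y\in\mathcal{Y}}\|v-y\|$. (iii) Stochastic subgradient oracle: given $y\in\mathcal{Y}$ it independently returns random vectors $s,g_1,\ldots,g_m\in\mathbb{V}$ with $\mathbb{E}\{s\mid y\}\in\partial f(y)$ and $\mathbb{E}\{g_i\mid y\}\in\partial h_i(y)$ for all $i$. There are constants $L,G,G_1,\ldots,G_m\ge 0$ such that always $\|g_i\|\le G_i$, $\sum_{i=1}^m G_i^2\le G^2$, and $\sqrt{\mathbb{E}\{\|s\|^2\mid y\}}\le L$. Each call uses fresh randomness: conditionally on the query point $y$, the output is independent of everything generated by the algorithm before the call. (iv) Function value oracle: given $y\in\mathcal{Y}$, it returns $h_1(y),\ldots,h_m(y)$. 4. An initial point $x_1\in\mathcal{X}$ is available. **Algorithm** (parameters $T\in\{1,2,\ldots\}$, $\eta,\alpha,\beta>0$, $\delta\ge0$). Set $y_1=x_1$, $Q_1=0\in\mathbb{V}$, obtain stochastic subgradients $s_1,g_{1,1},\ldots,g_{m,1}$ at $y_1$, and set $W_1=[-h(y_1)]_+\in\mathbb{R}^m$. For $t=1,\ldots,T-1$: - $x_{t+1}=\mathrm{InLMO}_{\mathcal{X}}\{-Q_t;\delta\}$; - $p_t=\eta Q_t+s_t+\beta\sum_{i=1}^m (W_{i,t}+h_i(y_t))\,g_{i,t}$; - $\tilde{y}_{t+1}=\dfrac{(\alpha+2G^2\beta)y_t+\eta x_{t+1}-p_t}{\alpha+2G^2\beta+\eta}$;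 - $y_{t+1}=\mathrm{PO}_{\mathcal{Y}}\{\tilde{y}_{t+1}\}$; - $Q_{t+1}=Q_t+y_{t+1}-x_{t+1}$; - obtain stochastic subgradients $s_{t+1},g_{1,t+1},\ldots,g_{m,t+1}$ at $y_{t+1}$; - for each $i$, $W_{i,t+1}=\max\{W_{i,t}+h_i(y_t)+\langle g_{i,t},y_{t+1}-y_t\rangle,\ [-h_i(y_{t+1})]_+\}$. Output: $\bar{x}_T=\frac1T\sum_{t=1}^T x_t$. *)

(* Defs.v *)
From mathcomp Require Export all_boot all_order all_algebra.
From mathcomp Require Export all_classical all_reals all_analysis.
Export Order.TTheory GRing.Theory Num.Theory numFieldNormedType.Exports.

Set Implicit Arguments.
Unset Strict Implicit.
Unset Printing Implicit Defensive.

Local Open Scope classical_set_scope.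
Local Open Scope ring_scope.

(* The inner-product space is a [normedModType] [V] (so that [continuous],
   [compact], [closed], [open] are the library's notions) together with a
   positive definite symmetric form [ip : {dot V for idfun}]; theorems assume
   that the norm of [V] is the one induced by [ip]. *)

Definition finite_dimensional (R : realType) (V : normedModType R) : Prop :=
  exists (n : nat) (e : 'I_n -> V),
    forall v : V, exists c : 'I_n -> R, v = \sum_(i < n) c i *: e i.

Notation borel V := (g_sigma_algebraType (@open V)).

Definition norm2 (R : realType) (m : nat) (u : 'I_m -> R) : R :=
  Num.sqrt (\sum_(i < m) u i ^+ 2).

Definition pospart (R : realType) (a : R) : R := Num.max 0 a.

Definition subdifferential (R : realType) (V : normedModType R)
    (ip : {dot V for idfun}) (f : V -> R) (y : V) : set V :=
  [set s | forall z, f y + ip s (z - y) <= f z].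

Definition is_projection (R : realType) (V : normedModType R) (Y : set V)
    (v z : V) : Prop :=
  Y z /\ forall y, Y y -> `|v - z| <= `|v - y|.

Section Problem.
Variables (R : realType) (V : normedModType R) (m : nat).
Variables (f : V -> R) (h : 'I_m -> V -> R) (X : set V).

Definition feasible : set V := [set x | X x /\ forall i, h i x <= 0].

Definition optimal_solutions : set V :=
  [set x | feasible x /\ forall z, feasible z -> f x <= f z].

Definition optimal_value : R := inf [set f x | x in feasible].

Definition lagrange_multiplier (mu : 'I_m -> R) : Prop :=
  (forall i, 0 <= mu i) /\
  forall x, X x -> optimal_value <= f x + \sum_(i < m) mu i * h i x.

End Problem.

Section Probability.
Context (R : realType) (d : measure_display) (Omega : measurableType d).
Variable P : probability Omega R.

(* [C] is a version of the conditional expectation of [Z] given the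
   sub-sigma-algebra [F]. *)
Definition is_cond_expectation (F : set (set Omega)) (Z C : Omega -> R)
    : Prop :=
  [/\ P.-integrable setT (EFin \o Z),
      P.-integrable setT (EFin \o C),
      forall B : set R, measurable B -> F (C @^-1` B)
    & forall A, F A ->
        (\int[P]_(w in A) (Z w)%:E = \int[P]_(w in A) (C w)%:E)%E].

Definition generated_by (d' : measure_display) (S : measurableType d')
    (Z : Omega -> S) : set (set Omega) :=
  preimage_set_system setT Z measurable.

(* [w |-> k w] is a version of the conditional law of [Z] given [F]. *)
Definition is_cond_law (d' : measure_display) (S : measurableType d')
    (F : set (set Omega)) (Z : Omega -> S) (k : Omega -> set S -> \bar R)
    : Prop :=
  measurable_fun setT Z /\
  forall B : set S, measurable B ->
    is_cond_expectation F (\1_(Z @^-1` B)) (fun w => fine (k w B)).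

End Probability.

Section Oracles.
Variables (R : realType) (V : normedModType R) (ip : {dot V for idfun}).

(* [e] is the expectation of the random vector [Z], defined through the
   expectations of its scalar components. *)
Definition is_vector_mean (d : measure_display) (S : measurableType d)
    (mu : {measure set S -> \bar R}) (Z : S -> V) (e : V) : Prop :=
  forall v : V,
    mu.-integrable setT (fun o => (ip (Z o) v)%:E) /\
    (\int[mu]_o (ip (Z o) v)%:E = (ip e v)%:E)%E.

(* [x] is the (random) answer of an inexact linear minimization oracle to the
   random query [v]. *)
Definition inexact_lmo_answer (d : measure_display) (Omega : measurableType d)
    (P : probability Omega R) (X : set V) (delta : R) (v x : Omega -> V)
    : Prop :=
  [/\ forall w, X (x w),
      measurable_fun setT (x : Omega -> borel V)
    & exists2 C : Omega -> R,
        is_cond_expectation P (generated_by (v : Omega -> borel V))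
          (fun w => ip (x w) (v w)) C
      & forall y, X y -> {ae P, forall w, C w <= ip y (v w) + delta}].

(* An answer of the subgradient oracle is a pair [o] with [s = o.1] and
   [g_i = tnth o.2 i]; the oracle is a probability kernel giving the law of its
   answer to each query.  The kernel is total, but it is only constrained at
   query points of [Y]. *)
Definition is_subgradient_oracle (m : nat) (f : V -> R) (h : 'I_m -> V -> R)
    (Y : set V) (L : R) (Gi : 'I_m -> R)
    (K : R.-pker borel V ~> (borel V * m.-tuple (borel V))%type) : Prop :=
  forall y : V, Y y ->
  [/\ (exists2 e, is_vector_mean (K y) (fun o => o.1 : V) e
                & subdifferential ip f y e),
      (forall i, exists2 e, is_vector_mean (K y) (fun o => tnth o.2 i : V) e
                          & subdifferential ip (h i) y e),
      (forall i, {ae K y, forall o, `|tnth o.2 i : V| <= Gi i})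
    & (sqrte (\int[K y]_o (`|o.1 : V| ^+ 2)%:E) <= L%:E)%E].

End Oracles.

Section Algorithm.
Variables (R : realType) (V : normedModType R) (ip : {dot V for idfun}).
Variables (m : nat) (h : 'I_m -> V -> R) (X Y : set V) (G : R) (x1 : V).
(* [K t] is the kernel of the [t]-th call of the subgradient oracle. *)
Variable K : nat -> R.-pker borel V ~> (borel V * m.-tuple (borel V))%type.
Variables (delta eta alpha beta : R) (T : nat).
Variables (d : measure_display) (Omega : measurableType d).
Variable P : probability Omega R.

(* Processes are indexed from [t = 1]; the values at [0] are irrelevant.
   [g_{i,t} w] is [tnth (g t w) i]. *)
Variables (x y Q s : nat -> Omega -> V) (W : nat -> Omega -> 'I_m -> R).
Variable g : nat -> Omega -> m.-tuple V.

Definition sgrad (t : nat) (w : Omega)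
  : (borel V * m.-tuple (borel V))%type := (s t w, g t w).

(* What is generated before the [t]-th call of the subgradient oracle: the
   points up to time [t] and the previous answers; the other quantities of the
   algorithm are functions of these. *)
Definition history (t : nat) : set (set Omega) :=
  <<s \bigcup_(k in [set k | (0 < k <= t)%N])
        (generated_by (x k : Omega -> borel V) `|`
         generated_by (y k : Omega -> borel V)) `|`
      \bigcup_(k in [set k | (0 < k < t)%N]) generated_by (sgrad k) >>.

Definition p_step (t : nat) (w : Omega) : V :=
  eta *: Q t w + s t w +
  beta *: \sum_(i < m) (W t w i + h i (y t w)) *: tnth (g t w) i.

Definition y_tilde (t : nat) (w : Omega) : V :=
  (alpha + 2 * G ^+ 2 * beta + eta)^-1 *:
  ((alpha + 2 * G ^+ 2 * beta) *: y t w + eta *: x t.+1 w - p_step t w).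

Record algorithm_run : Prop := AlgorithmRun {
  run_x1 : forall w, x 1 w = x1;
  run_y1 : forall w, y 1 w = x1;
  run_Q1 : forall w, Q 1 w = 0;
  run_W1 : forall w i, W 1 w i = pospart (- h i (y 1 w));
  run_sgrad : forall t, (0 < t <= T)%N ->
    is_cond_law P (history t) (sgrad t) (fun w => K t (y t w));
  run_x : forall t, (0 < t < T)%N ->
    inexact_lmo_answer ip P X delta (fun w => - Q t w) (x t.+1);
  run_y : forall t w, (0 < t < T)%N ->
    is_projection Y (y_tilde t w) (y t.+1 w);
  run_Q : forall t w, (0 < t < T)%N ->
    Q t.+1 w = Q t w + y t.+1 w - x t.+1 w;
  run_W : forall t w i, (0 < t < T)%N ->
    W t.+1 w i =
      Num.max (W t w i + h i (y t w) + ip (tnth (g t w) i) (y t.+1 w - y t w))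
              (pospart (- h i (y t.+1 w))) }.

Definition x_bar (w : Omega) : V := T%:R^-1 *: \sum_(1 <= t < T.+1) x t w.

Definition expected_violation : \bar R :=
  ('E_P[fun w => norm2 (fun i => pospart (h i (x_bar w)))])%E.

End Algorithm.

Section Constants.
Variables (R : realType) (L G D delta hx : R).
Let S := Num.sqrt (D ^+ 2 + 2 * delta).

Definition coefA2 : R :=
  55 * (G ^+ 3 / L) * D * S + 83 * G ^+ 2 * D ^+ 2
  + 8 * (G ^+ 4 / L ^+ 2) * (D ^+ 2 + 2 * delta).

Definition coefA1 : R :=
  16 * (G ^+ 3 / L) * (D ^+ 2 + 2 * delta) + 47 * G ^+ 2 * D * S.

(* [hx] stands for the Euclidean norm of [h xstar] *)
Definition coefA0 : R :=
  47 * G * L * D ^+ 2 + 47 * G * L * D * S + 47 * G ^+ 2 * D ^+ 2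
  + 12 * G ^+ 2 * (D ^+ 2 + 2 * delta)
  + 8 * G ^+ 2 * D * S + 8 * (G ^+ 3 / L) * D * S
  + hx ^+ 2 * (47 + 8 * (G / L) * (S / D)).

End Constants.

(* Main.v *)
Require Import Defs.
From HB Require Import structures.
From mathcomp Require Import measurable_realfun kernel.
From mathcomp Require Import ring lra.

(** The proof is a drift argument made along each trajectory and integrated once,
    at the end.

    Let [z] be an optimal solution and put [q = |Q_T|], [r = |y_T - z|],
    [rho = sum_(t < T) |y_(t+1) - y_t|], and let [w] be the Euclidean norm of the
    vector with entries [W_(T,i) - [-h_i(y_T)]_+].  The queue satisfies
    [Q_T = sum_(t <= T) (y_t - x_t)].  The average [xbar] lies in [X], hence in [Y],
    and a subgradient of [h_i] there has norm at most [G_i]; it gives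
    [T h_i(xbar) <= sum_t h_i(y_t) + G_i q].  The recursion for [W] in turn bounds
    [sum_t h_i(y_t)], so that [T |[h(xbar)]_+| <= U] with
    [U = w + G (r + q + rho)].  It remains to control [U].

    With [gamma = alpha + 2 G^2 beta], consider the potential
    [gamma/2 |y_t - z|^2 + eta/2 |Q_t|^2
     + beta/2 sum_i (W_(t,i)^2 - [-h_i(y_t)]_+^2)].
    The new point [y_(t+1)] minimises a strongly convex function over [Y]; comparing
    it with [z] shows ([drift_step]) that the potential grows in one step by at most
    a constant, minus [f(y_t) - f(z)], minus [beta G^2/2 |y_(t+1) - y_t|^2], plus a
    noise term which measures how far the answers of the oracles are from their
    conditional means.  After summation, the Lagrange multiplier bounds
    [sum_t (f(y_t) - f(z))] from below by [- L (q + r) - |mu| U].  The outcome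
    ([trajectory_bound]) bounds a nonnegative quadratic form in
    [(q, w, r, rho)] by a constant plus [L (q + r) + |mu| U] plus the total noise.
    By the Cauchy-Schwarz inequality [U^2] is at most a constant times this form, so
    the linear terms can be absorbed ([quadratic_tradeoff]) and there remains
    [U <= B + c * (total noise)]; the two choices of the parameters are worked out in
    [accuracy_bound] and [rate_bound].  As this is linear in the noise, taking
    expectations only requires every noise term to be integrable with nonpositive
    mean ([noise_nonpos_mean]).

    For the subgradient answers the sign of the mean comes from a disintegration
    ([disintegration]): the joint law of the past and of the answer is the law of the
    past composed with the kernel of the oracle, so that the mean can be computed by
    integrating the answer first, with [y_t] and the nonnegative weights
    [W_(t,i) + h_i(y_t)], which are functions of the past, held fixed.  Integrability
    is propagated along the run: [y_t], [Q_t] and [W_t] are square integrable because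
    the projection is nonexpansive, the [h_i] are Lipschitz on [Y] and the answers
    [g_(i,t)] are bounded. *)

Set Implicit Arguments.
Unset Strict Implicit.
Unset Printing Implicit Defensive.

Local Open Scope classical_set_scope.
Local Open Scope ring_scope.

(** * Inner products and Borel measurability of vector-valued functions *)

Section inner_product.
Variables (R : realType) (V : normedModType R) (ip : {dot V for idfun}).
Hypothesis normE : forall v : V, `|v| = Num.sqrt (ip v v).
Implicit Types u v w : V.

Lemma ipC u v : ip u v = ip v u.
Proof. by rewrite (@hermC _ _ _ _ ip) /= expr0 mul1r. Qed.

Lemma ipDl u v w : ip (u + v) w = ip u w + ip v w.
Proof. exact: linearDl. Qed.

Lemma ipDr u v w : ip w (u + v) = ip w u + ip w v.
Proof. exact: linearDr. Qed.

Lemma ipNl u v : ip (- u) v = - ip u v.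
Proof. exact: linearNl. Qed.

Lemma ipNr u v : ip u (- v) = - ip u v.
Proof. exact: linearNr. Qed.

Lemma ipBl u v w : ip (u - v) w = ip u w - ip v w.
Proof. exact: linearBl. Qed.

Lemma ipBr u v w : ip w (u - v) = ip w u - ip w v.
Proof. exact: linearBr. Qed.

Lemma ipZl a u v : ip (a *: u) v = a * ip u v.
Proof. exact: (@linearZl_LR). Qed.

Lemma ipZr a u v : ip u (a *: v) = a * ip u v.
Proof. by rewrite ipC ipZl ipC. Qed.

Lemma ip_suml (I : Type) (r : seq I) (E : I -> V) v :
  ip (\sum_(i <- r) E i) v = \sum_(i <- r) ip (E i) v.
Proof. exact: linear_sumlz. Qed.

Lemma ip_sumr (I : Type) (r : seq I) (E : I -> V) v :
  ip v (\sum_(i <- r) E i) = \sum_(i <- r) ip v (E i).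
Proof. exact: linear_sumr. Qed.

Lemma ip0l v : ip 0 v = 0.
Proof. exact: linear0l. Qed.

Lemma ip_ge0 v : 0 <= ip v v.
Proof.
have [->|v0] := eqVneq v 0; first by rewrite ip0l.
exact/ltW/neq0_dnorm_gt0.
Qed.

Lemma normV2 v : `|v| ^+ 2 = ip v v.
Proof. by rewrite normE sqr_sqrtr// ip_ge0. Qed.

Lemma normB2 u v : `|u - v| ^+ 2 = `|u| ^+ 2 - 2 * ip u v + `|v| ^+ 2.
Proof. by rewrite !normV2 ipBl !ipBr (ipC v u); ring. Qed.

Lemma normD2 u v : `|u + v| ^+ 2 = `|u| ^+ 2 + 2 * ip u v + `|v| ^+ 2.
Proof. by rewrite !normV2 ipDl !ipDr (ipC v u); ring. Qed.

(** Expresses the inner product through norms, which are continuous: this is how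
    the measurability of the inner product of two random vectors is obtained. *)
Lemma ip_polar u v : ip u v = (`|u + v| ^+ 2 - `|u| ^+ 2 - `|v| ^+ 2) / 2.
Proof. by rewrite normD2; field. Qed.

Lemma ip_cs u v : ip u v <= `|u| * `|v|.
Proof.
have h : ip u v <= (`|u| + `|v|) ^+ 2 / 2 - `|u| ^+ 2 / 2 - `|v| ^+ 2 / 2.
  rewrite ip_polar !mulrBl lerB// lerB// ler_pM2r ?invr_gt0//.
  by rewrite lerXn2r ?nnegrE ?addr_ge0 ?normr_ge0// ler_normD.
by apply: le_trans h _; lra.
Qed.

Lemma ip_cs_abs u v : `|ip u v| <= `|u| * `|v|.
Proof.
rewrite ler_norml ip_cs andbT lerNl -ipNl -(normrN u).
exact: ip_cs.
Qed.

Lemma continuous_ip v : continuous (fun u => ip u v).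
Proof.
move=> u; apply/cvgrPdist_le => e e0.
have d0 : 0 < e / (`|v| + 1) by rewrite divr_gt0// ltr_wpDl.
near=> w.
have uw : `|u - w| < e / (`|v| + 1).
  by near: w; apply: filterS (nbhsx_ballx u _ d0) => w; rewrite -ball_normE.
rewrite -ipBl (le_trans (ip_cs_abs _ _))//.
apply: (@le_trans _ _ ((e / (`|v| + 1)) * (`|v| + 1))).
  by apply: ler_pM => //; rewrite ?lerDl// ltW.
by rewrite divfK// gt_eqF// ltr_wpDl.
Unshelve. all: by end_near. Qed.

End inner_product.

Section borel_measurable.
Variables (R : realType) (V : normedModType R) (ip : {dot V for idfun}).
Hypothesis normE : forall v : V, `|v| = Num.sqrt (ip v v).
Hypothesis fdimV : finite_dimensional V.
Context (d : measure_display) (T : measurableType d).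
Implicit Types (Z : T -> V).

(** As [borel V] is only an alias of [V], the sigma-algebra of the target has to be
    named each time; this predicate does it. *)
Definition borel_fun Z := measurable_fun setT (Z : T -> borel V).

Lemma borel_fun_comp (phi : V -> R) Z : continuous phi -> borel_fun Z ->
  measurable_fun setT (phi \o Z).
Proof.
move=> cphi mZ.
apply: (measurability _ (RGenOpens.measurableE R)) => _ [_ [a [b ->] <-]].
rewrite setTI comp_preimage -[X in measurable X]setTI; apply: mZ => //.
apply: sub_sigma_algebra; apply: open_comp; last exact: interval_open.
by move=> v _; exact: cphi.
Qed.

Lemma borel_fun_ip Z v : borel_fun Z -> measurable_fun setT (fun w => ip (Z w) v).
Proof. exact: (borel_fun_comp (@continuous_ip _ _ _ normE v)). Qed.

Lemma borel_fun_norm Z : borel_fun Z -> measurable_fun setT (fun w => `|Z w|).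
Proof. exact: (borel_fun_comp (@norm_continuous _ _)). Qed.

(** The combinations of a finite spanning family with rational coefficients. *)
Lemma countable_dense : exists u : nat -> V,
  forall v e, 0 < e -> exists n, `|v - u n| < e.
Proof.
have [n [e spane]] := fdimV.
pose u (q : {ffun 'I_n -> rat}) : V := \sum_(i < n) ratr (q i) *: e i.
exists (fun k => if unpickle k is Some q then u q else 0) => v eps eps0.
have [c ->] := spane v.
pose M := \sum_(i < n) `|e i| + 1.
have M0 : 0 < M by rewrite ltr_wpDl// sumr_ge0.
have dq i : exists q : rat, `|c i - ratr q| < eps / M.
  have /rat_in_itvoo[q] : c i - eps / M < c i + eps / M.
    by rewrite ltrD2l gt0_cp// divr_gt0.
  rewrite in_itv/= => /andP[h1 h2]; exists q.
  by rewrite ltr_norml; apply/andP; split; lra.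
have [q qP] := choice dq.
exists (pickle [ffun i => q i]); rewrite pickleK /u -sumrB.
apply: le_lt_trans (ler_norm_sum _ _ _) _.
apply: (@le_lt_trans _ _ (\sum_(i < n) eps / M * `|e i|)).
  by apply: ler_sum => i _; rewrite ffunE -scalerBl normrZ ler_wpM2r// ltW.
rewrite -mulr_sumr -mulrA gtr_pMr// mulrC ltr_pdivrMr// mul1r /M.
by rewrite ltrDl.
Qed.

(** Measurability can be checked on components.  By density, closed balls around
    the points [u n] exhaust every open set, and such a ball is described by countably
    many components: [`|v| <= r] holds as soon as [ip v (u n) <= r * `|u n|] for all
    [n], because a point [u n] near [v] makes the Cauchy-Schwarz inequality nearly an
    equality. *)
Lemma borel_funP Z :
  (forall v, measurable_fun setT (fun w => ip (Z w) v)) -> borel_fun Z.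
Proof.
move=> mZ; have [u du] := countable_dense.
have norm_leP (r : R) (v : V) : 0 <= r ->
    (`|v| <= r <-> forall n, ip v (u n) <= r * `|u n|).
  move=> r0; split=> [vr n|h].
    by rewrite (le_trans (ip_cs normE _ _))// ler_wpM2r.
  rewrite leNgt; apply/negP => rv.
  (* Small enough for [`|v| ^+ 2 <= r * `|v| + e * (`|v| + r)] to fail. *)
  pose e := `|v| * (`|v| - r) / (2 * (`|v| + r)).
  have v0 : 0 < `|v| by exact: le_lt_trans rv.
  have vr0 : 0 < `|v| + r by rewrite ltr_wpDr.
  have e0 : 0 < e by rewrite /e divr_gt0 ?mulr_gt0 ?subr_gt0.
  have [n un] := du v e e0.
  have := h n; rewrite -[u n](subKr v) ipBr -(normV2 normE).
  have h1 := ip_cs normE v (v - u n).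
  have h2 : `|v - (v - u n)| <= `|v| + `|v - u n| by exact: ler_normB.
  have h3 : `|v| * `|v - u n| <= `|v| * e by rewrite ler_wpM2l// ltW.
  have h4 : r * `|v - (v - u n)| <= r * (`|v| + e).
    by rewrite ler_wpM2l// (le_trans h2)// lerD2l ltW.
  have h5 : e * (`|v| + r) = `|v| * (`|v| - r) / 2.
    by rewrite /e; field; rewrite gt_eqF.
  have : 0 < `|v| * (`|v| - r) by rewrite mulr_gt0// subr_gt0.
  nra.
have mball c (r : R) : 0 <= r -> measurable [set w | `|Z w - c| <= r].
  move=> r0; rewrite (_ : [set _ | _] =
      \bigcap_n [set w | ip (Z w - c) (u n) <= r * `|u n|]); last first.
    apply/seteqP; split => w /=.
      by move=> /(norm_leP _ _ r0) h n _ /=.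
    by move=> h; apply/(norm_leP _ _ r0) => n; exact: h.
  apply: bigcapT_measurable => n.
  have : measurable_fun setT (fun w => ip (Z w - c) (u n) <= r * `|u n|).
    apply: measurable_fun_ler => //.
    under eq_fun do rewrite ipBl.
    by apply: measurable_funB => //; exact: mZ.
  by move=> /(_ measurableT [set true] I); rewrite setTI.
apply: (@measurability _ _ _ (borel V) _ _ (@open V) (erefl _)) => _ [U oU <-].
rewrite setTI; pose A (nk : nat * nat) : set T :=
  if `[< forall v, `|v - u nk.1| <= nk.2.+1%:R^-1 -> U v >]
  then [set w | `|Z w - u nk.1| <= nk.2.+1%:R^-1] else set0.
rewrite (_ : _ @^-1` _ = \bigcup_nk A nk); last first.
  apply/seteqP; split => w /=.
    move=> Uw.
    have /nbhs_ballP[e /= e0 eU] : nbhs (Z w) U by exact: open_nbhs_nbhs.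
    have [k _ ke] := near_infty_natSinv_lt (PosNum (divr_gt0 e0 (ltr0n R 2))).
    have := ke k (leqnn k) => /= {}ke.
    have [n un] := du (Z w) k.+1%:R^-1 ltac:(by rewrite invr_gt0).
    exists (n, k) => //=; rewrite /A /=; case: asboolP => [_|]; first exact/ltW.
    case=> v vu; apply: eU; rewrite -ball_normE /ball_ /=.
    rewrite -(subrK (u n) (Z w)) -addrA (le_lt_trans (ler_normD _ _))//.
    rewrite (distrC (u n)).
    move: un vu ke; set q := _^-1; lra.
  by case=> -[n k] _; rewrite /A; case: asboolP => // UP /= /UP.
apply: countable_bigcupT_measurable; first exact: countableP.
move=> [n k]; rewrite /A; case: asboolP => _ //; apply: mball.
by rewrite invr_ge0.
Qed.

Lemma borel_fun_cst (c : V) : borel_fun (fun=> c).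
Proof. exact: measurable_cst. Qed.

Lemma borel_funD Z1 Z2 : borel_fun Z1 -> borel_fun Z2 ->
  borel_fun (fun w => Z1 w + Z2 w).
Proof.
move=> m1 m2; apply: borel_funP => v; under eq_fun do rewrite ipDl.
by apply: measurable_funD; exact: borel_fun_ip.
Qed.

Lemma borel_funZ (a : T -> R) Z : measurable_fun setT a -> borel_fun Z ->
  borel_fun (fun w => a w *: Z w).
Proof.
move=> ma mZ; apply: borel_funP => v; under eq_fun do rewrite ipZl.
by apply: measurable_funM => //; exact: borel_fun_ip.
Qed.

Lemma borel_funN Z : borel_fun Z -> borel_fun (fun w => - Z w).
Proof.
move=> mZ; under eq_fun do rewrite -scaleN1r.
by apply: borel_funZ => //; exact: measurable_cst.
Qed.

Lemma borel_funB Z1 Z2 : borel_fun Z1 -> borel_fun Z2 ->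
  borel_fun (fun w => Z1 w - Z2 w).
Proof. by move=> m1 m2; apply: borel_funD => //; exact: borel_funN. Qed.

Lemma borel_fun_sum (I : Type) (r : seq I) (Z : I -> T -> V) :
  (forall i, borel_fun (Z i)) -> borel_fun (fun w => \sum_(i <- r) Z i w).
Proof.
move=> mZ; elim: r => [|i r ih].
  by under eq_fun do rewrite big_nil; exact: borel_fun_cst.
by under eq_fun do rewrite big_cons; exact: borel_funD.
Qed.

Lemma borel_fun_ip2 Z1 Z2 : borel_fun Z1 -> borel_fun Z2 ->
  measurable_fun setT (fun w => ip (Z1 w) (Z2 w)).
Proof.
move=> m1 m2; under eq_fun do rewrite (ip_polar normE).
apply: measurable_funM; last exact: measurable_cst.
apply: measurable_funB; first apply: measurable_funB;
  apply: measurable_funX; apply: borel_fun_norm => //.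
exact: borel_funD.
Qed.

(** For a projected random point.  An open set of values of [Z2] pulls back to the
    same event as a union of balls around values of [Z1], so it is enough to know the
    projection on the range of [Z1]. *)
Lemma borel_fun_nonexpansive Z1 Z2 : borel_fun Z1 ->
  (forall w w', `|Z2 w - Z2 w'| <= `|Z1 w - Z1 w'|) -> borel_fun Z2.
Proof.
move=> m1 h.
apply: (@measurability _ _ _ (borel V) _ _ (@open V) (erefl _)) => _ [U oU <-].
rewrite setTI.
pose O := [set v : V | exists w e, [/\ 0 < e, ball (Z2 w) e `<=` U
                                   & ball (Z1 w) e v]].
rewrite (_ : _ @^-1` _ = Z1 @^-1` O).
  rewrite -[X in measurable X]setTI; apply: m1 => //; apply: sub_sigma_algebra.
  rewrite openE => v [w [e [e0 eU wv]]].
  have : nbhs v (ball (Z1 w) e).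
    by apply: open_nbhs_nbhs; split => //; exact: ball_open.
  by apply: filterS => v' wv'; exists w, e.
apply/seteqP; split => w /=.
  move=> Uw.
  have /nbhs_ballP[e /= e0 eU] : nbhs (Z2 w) U by exact: open_nbhs_nbhs.
  by exists w, e; split => //; exact: ballxx.
move=> [w' [e [e0 eU]]]; rewrite -ball_normE /ball_ /= => ww'; apply: eU.
by rewrite -ball_normE /ball_ /=; exact: le_lt_trans (h _ _) ww'.
Qed.

End borel_measurable.

(** * Euclidean norms and projections *)

Section euclidean_norm.
Variables (R : realType) (m : nat).
Implicit Types u v : 'I_m -> R.

Lemma norm2_ge0 u : 0 <= norm2 u.
Proof. exact: sqrtr_ge0. Qed.

Lemma norm2E u : norm2 u ^+ 2 = \sum_(i < m) u i ^+ 2.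
Proof. by rewrite sqr_sqrtr// sumr_ge0// => i _; rewrite sqr_ge0. Qed.

(** Cauchy-Schwarz with upper bounds in place of the norms, as in the hypothesis
    on [G]; it sums the inequalities [0 <= (b * u i - a * v i) ^+ 2]. *)
Lemma sum_mul_le (a b : R) u v : 0 <= a -> 0 <= b ->
  \sum_(i < m) u i ^+ 2 <= a ^+ 2 -> \sum_(i < m) v i ^+ 2 <= b ^+ 2 ->
  \sum_(i < m) u i * v i <= a * b.
Proof.
move=> a0 b0 ua vb; set S := \sum_(i < m) u i * v i.
have h : 2 * (a * b) * S <= 2 * (a * b) * (a * b).
  have : \sum_(i < m) (2 * (a * b) * (u i * v i))
      <= \sum_(i < m) (b ^+ 2 * u i ^+ 2 + a ^+ 2 * v i ^+ 2).
    by apply: ler_sum => i _; have := sqr_ge0 (b * u i - a * v i); nra.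
  rewrite -mulr_sumr big_split/= -!mulr_sumr => /le_trans; apply.
  have := ler_wpM2l (sqr_ge0 b) ua; have := ler_wpM2l (sqr_ge0 a) vb.
  by rewrite -/S; nra.
have [ab|] := ltP 0 (a * b); first by rewrite ler_pM2l// mulr_gt0 in h.
move=> ab; have {}ab : a * b = 0 by apply/eqP; rewrite eq_le ab mulr_ge0.
rewrite ab /S big1// => i _; move/eqP: ab; rewrite mulf_eq0.
have sq0 (c : R) (w : 'I_m -> R) : \sum_(j < m) w j ^+ 2 <= c ^+ 2 -> c = 0 ->
    w i = 0.
  move=> wc c0; apply/eqP; rewrite -sqrf_eq0 eq_le sqr_ge0 andbT.
  move: wc; rewrite c0 expr0n /=; apply: le_trans; rewrite (bigD1 i)//= lerDl.
  by rewrite sumr_ge0// => j _; rewrite sqr_ge0.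
by case/orP => /eqP c0; [rewrite (sq0 _ _ ua c0) mul0r|rewrite (sq0 _ _ vb c0) mulr0].
Qed.

(** The triangle inequality for [v + t *: Gi], together with the monotonicity of
    the norm on nonnegative entries. *)
Lemma norm2_le (G t : R) (Gi : 'I_m -> R) u v : 0 <= G -> 0 <= t ->
  \sum_(i < m) Gi i ^+ 2 <= G ^+ 2 ->
  (forall i, 0 <= u i <= v i + Gi i * t) ->
  norm2 u <= norm2 v + G * t.
Proof.
move=> G0 t0 GiG uv.
have vt0 : 0 <= norm2 v + G * t by rewrite addr_ge0 ?norm2_ge0 ?mulr_ge0.
rewrite -(ger0_norm vt0) -sqrtr_sqr ler_wsqrtr//.
apply: (@le_trans _ _ (\sum_(i < m) (v i ^+ 2 + 2 * t * (v i * Gi i)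
    + t ^+ 2 * Gi i ^+ 2))).
  apply: ler_sum => i _; have /andP[u0 uvi] := uv i.
  apply: (@le_trans _ _ ((v i + Gi i * t) ^+ 2)); last by lra.
  by rewrite lerXn2r// nnegrE (le_trans u0).
rewrite !big_split/= -!mulr_sumr -norm2E.
have h1 : \sum_(i < m) v i * Gi i <= norm2 v * G.
  by apply: sum_mul_le; rewrite ?norm2_ge0// norm2E.
have h2 := ler_wpM2l (sqr_ge0 t) GiG.
have h3 := ler_wpM2l t0 h1.
by nra.
Qed.

End euclidean_norm.

Section projection.
Variables (R : realType) (V : normedModType R) (ip : {dot V for idfun}).
Hypothesis normE : forall v : V, `|v| = Num.sqrt (ip v v).
Implicit Types (u v z : V) (A : set V).

Lemma convex_comb A u v (l : R) : convex_set A -> A u -> A v ->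
  0 <= l -> l <= 1 -> A (l *: u + (1 - l) *: v).
Proof.
move=> cA Au Av l0 l1.
have := cA u v (Itv01 l0 l1) (mem_set Au) (mem_set Av).
by rewrite inE.
Qed.

Lemma three_point_identity u v z : 2 * ip (u - v) (z - v)
  = `|u - v| ^+ 2 + `|z - v| ^+ 2 - `|u - z| ^+ 2.
Proof. by rewrite !(normV2 normE) !(ipBl, ipBr) !(ipC _ v) (ipC _ z u); ring. Qed.

(** Otherwise, moving from [z] towards [u] by the fraction [a / (a + b)], where [a]
    is the inner product and [b] is [`|u - z| ^+ 2], would bring the point closer to
    [v]. *)
Lemma projection_ip_le0 A v z u : convex_set A -> is_projection A v z -> A u ->
  ip (v - z) (u - z) <= 0.
Proof.
move=> cA [Az minz] Au; rewrite leNgt; apply/negP => a0.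
set a := ip _ _ in a0; set b := `|u - z| ^+ 2.
have b0 : 0 <= b by exact: sqr_ge0.
have ab0 : 0 < a + b by rewrite ltr_wpDr.
pose l := a / (a + b).
have l0 : 0 < l by rewrite divr_gt0.
have l1 : l <= 1 by rewrite ler_pdivrMr// mul1r lerDl.
have := minz _ (convex_comb cA Au Az (ltW l0) l1).
rewrite -(@ler_pXn2r _ 2%N)// ?nnegrE ?normr_ge0//.
have -> : v - (l *: u + (1 - l) *: z) = (v - z) - l *: (u - z).
  by rewrite scalerBl scalerBr scale1r addrCA opprD addrA.
rewrite [leRHS](normB2 normE) ipZr -/a normrZ exprMn (ger0_norm (ltW l0)) -/b.
have lab : l * (a + b) = a by rewrite /l divfK// gt_eqF.
nra.
Qed.

Lemma projection_nonexpansive A v1 v2 z1 z2 : convex_set A ->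
  is_projection A v1 z1 -> is_projection A v2 z2 -> `|z1 - z2| <= `|v1 - v2|.
Proof.
move=> cA p1 p2.
have h1 := projection_ip_le0 cA p1 p2.1.
have h2 := projection_ip_le0 cA p2 p1.1.
have h3 := ip_cs normE (v1 - v2) (z1 - z2).
have h4 : `|z1 - z2| ^+ 2 <= ip (v1 - v2) (z1 - z2).
  rewrite (normV2 normE); move: h1 h2; rewrite !(ipBl, ipBr); lra.
have [//|z12] := leP `|z1 - z2| `|v1 - v2|.
have := normr_ge0 (v1 - v2); nra.
Qed.

(** The projected point minimises
    [u |-> ip p u + gam / 2 * `|u - y| ^+ 2 + eta / 2 * `|u - x| ^+ 2] over [A], and
    the three-point identity turns its variational inequality into the comparison of
    the values at [y'] and [z], with the gain due to strong convexity. *)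
Lemma projected_step A (gam eta : R) y x p y' z :
  convex_set A -> 0 < gam + eta -> A z ->
  is_projection A ((gam + eta)^-1 *: (gam *: y + eta *: x - p)) y' ->
  gam / 2 * (`|y' - y| ^+ 2 + `|y' - z| ^+ 2 - `|y - z| ^+ 2)
  + eta / 2 * (`|x - y'| ^+ 2 + `|y' - z| ^+ 2 - `|x - z| ^+ 2)
  + ip p (y' - z) <= 0.
Proof.
move=> cA ge0 Az py'; have := projection_ip_le0 cA py' Az.
rewrite -(pmulr_rle0 _ ge0) -ipZl scalerBr scalerA divff ?gt_eqF// scale1r.
have -> : gam *: y + eta *: x - p - (gam + eta) *: y'
    = gam *: (y - y') + eta *: (x - y') - p.
  by rewrite scalerDl !scalerBr opprD [LHS]addrAC; congr (_ - p); rewrite addrACA.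
rewrite ipBl ipDl !ipZl -(opprB y' z) ipNr.
have := three_point_identity y y' z; have := three_point_identity x y' z.
rewrite (distrC z y') (distrC y y') -(opprB y' z) !ipNr; nra.
Qed.

End projection.

(** * One step of the algorithm *)

Section drift.
Variables (R : realType) (V : normedModType R) (ip : {dot V for idfun}).
Hypothesis normE : forall v : V, `|v| = Num.sqrt (ip v v).
Variables (m : nat) (Y : set V) (Gi : 'I_m -> R) (D delta L G : R).
Variables (eta alpha beta : R).
Hypotheses (convY : convex_set Y) (G0 : 0 <= G)
  (sumG : \sum_(i < m) Gi i ^+ 2 <= G ^+ 2)
  (eta0 : 0 < eta) (alpha0 : 0 < alpha) (beta0 : 0 < beta).
Let gam := alpha + 2 * G ^+ 2 * beta.

Lemma pospart_ge0 (a : R) : 0 <= pospart a.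
Proof. by rewrite /pospart le_max lexx. Qed.

Lemma ge_pospart (a : R) : a <= pospart a.
Proof. by rewrite /pospart le_max lexx orbT. Qed.

Lemma sqr_max_le (a b : R) : Num.max a b ^+ 2 <= a ^+ 2 + b ^+ 2.
Proof.
by have := sqr_ge0 a; have := sqr_ge0 b; case: (leP a b) => _; lra.
Qed.

(** The answers of the oracles enter the drift inequality only through this
    quantity.  Replacing [s] and the [g i] by subgradients at [y] makes the first two
    terms nonpositive (for [fyz = f y - f z], [hy i = h i y], nonnegative weights and
    [h i z <= 0]); the third compares the answer of the linear minimization oracle with
    [z], the last one the square of [s] with its bound. *)
Definition noise (fyz : R) (y x' Q s z : V) (g : 'I_m -> V) (W hy : 'I_m -> R) :=
  (fyz - ip s (y - z))
  + beta * \sum_(i < m) (W i + hy i) * (hy i - ip (g i) (y - z))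
  + eta * (ip Q (z - x') - delta)
  + (`|s| ^+ 2 - L ^+ 2) / (2 * alpha).

(** The step inequality of the projection is combined with three expansions.  The
    increase of the squared queue contains [ip Q (y' - x')], to which the queue term of
    the linear part of the step is compared.  By
    [Num.max a b ^+ 2 <= a ^+ 2 + b ^+ 2], the squares of the weights produce the terms
    in [g i] at the cost of [G ^+ 2 * `|y' - y| ^+ 2].  Finally [ip s (y' - y)] is
    split by Young's inequality.  The quadratic cost of a move is
    [alpha / 2 + beta * G ^+ 2 / 2], and [gam / 2] exceeds it by [beta * G ^+ 2 / 2],
    which is kept: it controls the length of the path. *)
Lemma drift_step (fyz : R) (y x' y' Q s z : V) (g : 'I_m -> V)
    (W W' hy hy' : 'I_m -> R) :
  Y z -> `|x' - z| <= D ->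
  is_projection Y ((gam + eta)^-1 *: (gam *: y + eta *: x' -
     (eta *: Q + s + beta *: \sum_(i < m) (W i + hy i) *: g i))) y' ->
  (forall i, 0 <= W i + hy i) -> (forall i, `|g i| <= Gi i) ->
  (forall i, W' i = Num.max (W i + hy i + ip (g i) (y' - y))
                            (pospart (- hy' i))) ->
  gam / 2 * (`|y' - z| ^+ 2 - `|y - z| ^+ 2)
  + eta / 2 * (`|Q + y' - x'| ^+ 2 - `|Q| ^+ 2)
  + beta / 2 * (\sum_(i < m) (W' i ^+ 2 - pospart (- hy' i) ^+ 2)
                - \sum_(i < m) (W i ^+ 2 - pospart (- hy i) ^+ 2))
  + beta * G ^+ 2 / 2 * `|y' - y| ^+ 2 + fyz
  <= noise fyz y x' Q s z g W hy
     + (eta * (D ^+ 2 + 2 * delta) / 2 + L ^+ 2 / (2 * alpha)).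
Proof.
move=> Yz xzD py' a_ge0 g_le W'E.
have gam0 : 0 < gam + eta.
  have := mulr_ge0 (sqr_ge0 G) (ltW beta0); rewrite /gam; move: eta0 alpha0; lra.
have := projected_step normE convY gam0 Yz py'.
have QE : `|Q + y' - x'| ^+ 2 - `|Q| ^+ 2 = 2 * ip Q (y' - x') + `|x' - y'| ^+ 2.
  by rewrite -(addrA Q) (normD2 normE Q) (distrC x'); ring.
have y'zE : y' - z = (y' - y) + (y - z) by rewrite addrA subrK.
have xz2 : `|x' - z| ^+ 2 <= D ^+ 2 by rewrite lerXn2r ?nnegrE ?(le_trans _ xzD).
have sE : - (`|s| ^+ 2 / (2 * alpha)) - alpha / 2 * `|y' - y| ^+ 2 <= ip s (y' - y).
  have := ip_cs_abs normE s (y' - y); rewrite ler_norml => /andP[+ _].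
  apply: le_trans; set b := `|_|; set c := `|_|.
  have bE : b = alpha * (b / alpha) by rewrite mulrC divfK// gt_eqF.
  move: bE; set k := b / alpha => ->.
  have -> : (alpha * k) ^+ 2 / (2 * alpha) = alpha / 2 * k ^+ 2.
    by field; rewrite gt_eqF.
  by have := mulr_ge0 (ltW alpha0) (sqr_ge0 (k - c)); lra.
have hE : \sum_(i < m) (W' i ^+ 2 - pospart (- hy' i) ^+ 2)
     - \sum_(i < m) (W i ^+ 2 - pospart (- hy i) ^+ 2) - G ^+ 2 * `|y' - y| ^+ 2
   <= 2 * \sum_(i < m) ((W i + hy i) * ip (g i) (y' - y) + (W i + hy i) * hy i).
  have hG := ler_wpM2r (sqr_ge0 `|y' - y|) sumG; rewrite mulr_suml in hG.
  have : \sum_(i < m) ((W' i ^+ 2 - pospart (- hy' i) ^+ 2)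
                      - (W i ^+ 2 - pospart (- hy i) ^+ 2))
      <= \sum_(i < m) (2 * ((W i + hy i) * ip (g i) (y' - y) + (W i + hy i) * hy i)
                      + Gi i ^+ 2 * `|y' - y| ^+ 2).
    apply: ler_sum => i _; rewrite W'E.
    have := sqr_max_le (W i + hy i + ip (g i) (y' - y)) (pospart (- hy' i)).
    have : ip (g i) (y' - y) ^+ 2 <= Gi i ^+ 2 * `|y' - y| ^+ 2.
      rewrite -exprMn -(real_normK (num_real (ip _ _))) lerXn2r ?nnegrE ?mulr_ge0//.
        by rewrite (le_trans _ (g_le i)).
      by rewrite (le_trans (ip_cs_abs normE _ _))// ler_wpM2r.
    have : pospart (- hy i) ^+ 2 <= hy i ^+ 2.
      by rewrite /pospart; have := sqr_ge0 (hy i); case: (leP 0 (- hy i)) => _; lra.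
    lra.
  rewrite sumrB [leRHS]big_split/= -mulr_sumr; move: hG; lra.
rewrite QE /noise; set p := eta *: Q + s + _.
have -> : ip p (y' - z) = eta * ip Q (y' - z) + (ip s (y' - y) + ip s (y - z))
   + beta * (\sum_(i < m) ((W i + hy i) * ip (g i) (y' - y) + (W i + hy i) * hy i)
             - \sum_(i < m) (W i + hy i) * (hy i - ip (g i) (y - z))).
  rewrite /p 2!ipDl 2!ipZl -(ipDr _ _ _ s) -y'zE ip_suml -sumrB.
  congr (_ + _ * _); apply: eq_bigr => i _.
  by rewrite ipZl y'zE ipDr; ring.
have -> : ip Q (y' - z) = ip Q (y' - x') - ip Q (z - x').
  by rewrite -ipBr opprB addrA subrK.
have eta20 : 0 <= eta / 2 by rewrite divr_ge0// ltW.
have beta20 : 0 <= beta / 2 by rewrite divr_ge0// ltW.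
have := ler_wpM2l beta20 hE; have := ler_wpM2l eta20 xz2.
have := mulr_ge0 eta20 (sqr_ge0 `|y' - z|).
move: sE; rewrite /gam; lra.
Qed.

End drift.

(** * A whole trajectory *)

Section subgradients.
Variables (R : realType) (V : normedModType R) (ip : {dot V for idfun}).
Hypothesis normE : forall v : V, `|v| = Num.sqrt (ip v v).

(** Subgradients are only asked for at points of [Y], the query points of the
    oracle; this makes [phi] Lipschitz on [Y]. *)
Definition bounded_subgradient (Y : set V) (C : R) (phi : V -> R) :=
  forall y, Y y -> exists2 e, subdifferential ip phi y e & `|e| <= C.

Lemma bounded_subgradient_lip Y C phi u v : bounded_subgradient Y C phi ->
  Y u -> phi u - phi v <= C * `|u - v|.
Proof.
move=> sub Yu; have [e /(_ v) eP eC] := sub u Yu.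
have := ip_cs_abs normE e (v - u); rewrite ler_norml => /andP[+ _].
rewrite (distrC v); have := ler_wpM2r (normr_ge0 (u - v)) eC.
move: eP; rewrite /subdifferential /=; lra.
Qed.

(** A single subgradient, at [v], is used for all the [y t]: the errors [y t - v]
    then add up before their norm is taken. *)
Lemma bounded_subgradient_avg Y C phi v (n : nat) (y : nat -> V) (q : V) :
  bounded_subgradient Y C phi -> Y v -> \sum_(1 <= t < n.+1) (y t - v) = q ->
  n%:R * phi v <= \sum_(1 <= t < n.+1) phi (y t) + C * `|q|.
Proof.
move=> sub Yv qE; have [e eP eC] := sub v Yv.
have : \sum_(1 <= t < n.+1) (phi v + ip e (y t - v)) <= \sum_(1 <= t < n.+1) phi (y t).
  by apply: ler_sum => t _; exact: eP.
rewrite big_split/= -ip_sumr qE big_const_nat iter_addr_0 subSS subn0 -mulr_natl.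
have := ip_cs_abs normE e q; rewrite ler_norml => /andP[+ _].
have := ler_wpM2r (normr_ge0 q) eC; lra.
Qed.

Lemma convex_average (X : set V) (n : nat) (x : nat -> V) : convex_set X ->
  (0 < n)%N -> (forall t, (0 < t <= n)%N -> X (x t)) ->
  X (n%:R^-1 *: \sum_(1 <= t < n.+1) x t).
Proof.
move=> cX; elim: n => // -[|n] ih _ Xx.
  by rewrite big_nat1 invr1 scale1r; exact: Xx.
have {}ih : X (n.+1%:R^-1 *: \sum_(1 <= t < n.+2) x t).
  by apply: ih => // t /andP[t0 tn]; apply: Xx; rewrite t0 ltnW.
have l01 : n.+1%:R / n.+2%:R <= 1 :> R by rewrite ler_pdivrMr// mul1r ler_nat.
have Xn : X (x n.+2) by apply: Xx; rewrite leqnn.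
have := convex_comb cX ih Xn (divr_ge0 (ler0n _ _) (ler0n _ _)) l01.
rewrite scalerA mulrAC divff ?pnatr_eq0// mul1r.
have -> : 1 - n.+1%:R / n.+2%:R = n.+2%:R^-1 :> R.
  by rewrite -[n.+2%:R]natr1; field; rewrite gt_eqF//; have := ler0n R n; lra.
by rewrite -scalerDr -(big_nat_recr n.+2).
Qed.

End subgradients.

Section trajectory.
Variables (R : realType) (V : normedModType R) (ip : {dot V for idfun}).
Hypothesis normE : forall v : V, `|v| = Num.sqrt (ip v v).
Variables (m : nat) (f : V -> R) (h : 'I_m -> V -> R) (X Y : set V).
Variables (D delta L G : R) (Gi mu : 'I_m -> R) (z : V).
Variables (eta alpha beta : R) (T : nat).
Hypotheses (convX : convex_set X) (convY : convex_set Y) (subXY : X `<=` Y)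
  (diamX : forall u v, X u -> X v -> `|u - v| <= D)
  (delta0 : 0 <= delta) (L0 : 0 <= L) (G0 : 0 <= G) (Gi0 : forall i, 0 <= Gi i)
  (sumG : \sum_(i < m) Gi i ^+ 2 <= G ^+ 2)
  (eta0 : 0 < eta) (alpha0 : 0 < alpha) (beta0 : 0 < beta) (T0 : (0 < T)%N)
  (subf : bounded_subgradient ip Y L f)
  (subh : forall i, bounded_subgradient ip Y (Gi i) (h i))
  (Xz : X z) (hz : forall i, h i z <= 0)
  (mu0 : forall i, 0 <= mu i)
  (lagr : forall u, X u -> f z <= f u + \sum_(i < m) mu i * h i u).

Variables (x y Q s : nat -> V) (W : nat -> 'I_m -> R) (g : nat -> 'I_m -> V).
Let gam := alpha + 2 * G ^+ 2 * beta.
Hypotheses (y1 : y 1%N = x 1%N) (Q1 : Q 1%N = 0)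
  (W1 : forall i, W 1%N i = pospart (- h i (y 1%N)))
  (Xx : forall t, (0 < t <= T)%N -> X (x t))
  (Yy : forall t, (0 < t <= T)%N -> Y (y t))
  (g_le : forall t i, (0 < t < T)%N -> `|g t i| <= Gi i)
  (yS : forall t, (0 < t < T)%N -> is_projection Y
     ((gam + eta)^-1 *: (gam *: y t + eta *: x t.+1 -
       (eta *: Q t + s t + beta *: \sum_(i < m) (W t i + h i (y t)) *: g t i)))
     (y t.+1))
  (QS : forall t, (0 < t < T)%N -> Q t.+1 = Q t + y t.+1 - x t.+1)
  (WS : forall t i, (0 < t < T)%N -> W t.+1 i =
     Num.max (W t i + h i (y t) + ip (g t i) (y t.+1 - y t))
             (pospart (- h i (y t.+1)))).

(** The trajectory is deterministic in this part; a random run is obtained by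
    fixing the outcome. *)
Definition run_noise t :=
  noise ip delta L eta alpha beta (f (y t) - f z) (y t) (x t.+1) (Q t) (s t) z
    (g t) (W t) (h ^~ (y t)).

(** Vanishes at time 1 by the initialisation of the weights, and dominates the
    squared norm of the vector [W T i - pospart (- h i (y T))]. *)
Let omega t := \sum_(i < m) (W t i ^+ 2 - pospart (- h i (y t)) ^+ 2).
Let potential t := gam / 2 * `|y t - z| ^+ 2 + eta / 2 * `|Q t| ^+ 2
  + beta / 2 * omega t.

Lemma W_ge t i : (0 < t <= T)%N -> pospart (- h i (y t)) <= W t i.
Proof.
case: t => // -[|t] tT; first by rewrite W1.
by rewrite WS// le_max lexx orbT.
Qed.

(** These weights multiply the subgradient inequalities of the [h i], which is only
    possible because of their sign. *)
Lemma Wh_ge0 t i : (0 < t <= T)%N -> 0 <= W t i + h i (y t).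
Proof.
move=> /(@W_ge _ i); have := ge_pospart (- h i (y t)); lra.
Qed.

Lemma potential_le n : (0 < n <= T)%N ->
  potential n + \sum_(1 <= t < n) (beta * G ^+ 2 / 2 * `|y t.+1 - y t| ^+ 2
      + (f (y t) - f z))
  <= gam / 2 * D ^+ 2 + \sum_(1 <= t < n) run_noise t
     + n%:R * (eta * (D ^+ 2 + 2 * delta) / 2 + L ^+ 2 / (2 * alpha)).
Proof.
set c := eta * _ / 2 + _.
have c0 : 0 <= c.
  have : 0 <= L ^+ 2 / (2 * alpha) by rewrite divr_ge0 ?sqr_ge0// mulr_ge0// ltW.
  have : 0 <= eta * (D ^+ 2 + 2 * delta).
    by rewrite mulr_ge0 ?(ltW eta0)// addr_ge0 ?sqr_ge0 ?mulr_ge0.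
  by rewrite /c; lra.
have gam0 : 0 <= gam / 2.
  have := mulr_ge0 (sqr_ge0 G) (ltW beta0); move: alpha0; rewrite /gam; lra.
elim: n => // -[|n] ih nT.
  rewrite !big_geq// /potential /omega big1 => [|i _]; last by rewrite W1 subrr.
  rewrite Q1 normr0 expr0n /= !mulr0 !addr0 mul1r.
  have : `|y 1%N - z| ^+ 2 <= D ^+ 2.
    have xzD : `|y 1%N - z| <= D by rewrite y1; apply: diamX => //; exact: Xx.
    by rewrite lerXn2r ?nnegrE ?(le_trans _ xzD).
  by move=> /(ler_wpM2l gam0); move: c0; lra.
have nT' : (0 < n.+1 < T)%N by [].
have := drift_step normE delta L convY sumG eta0 alpha0 beta0 (f (y n.+1) - f z)
  (subXY Xz) (diamX (Xx nT) Xz) (yS nT')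
  (fun i => Wh_ge0 i (ltnW nT' : (0 < n.+1 <= T)%N)) (fun i => g_le i nT')
  (fun i => WS i nT').
have {ih} := ih (ltnW nT' : (0 < n.+1 <= T)%N).
rewrite !(big_nat_recr n.+1)//= -(QS nT') -[n.+2%:R]natr1.
rewrite /potential -/(run_noise n.+1) -/(omega n.+2) -/(omega n.+1) -/c -/gam; lra.
Qed.

(** The weights grow at least by [h i (y t) + ip (g t i) (y t.+1 - y t)]. *)
Lemma W_sum_le i n : (0 < n <= T)%N ->
  \sum_(1 <= t < n) h i (y t)
  <= W n i + Gi i * \sum_(1 <= t < n) `|y t.+1 - y t|.
Proof.
elim: n => // -[|n] ih nT.
  by rewrite !big_geq// mulr0 addr0 W1 pospart_ge0.
have nT' : (0 < n.+1 < T)%N by [].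
have {ih} := ih (ltnW nT' : (0 < n.+1 <= T)%N).
rewrite !(big_nat_recr n.+1)//= (WS i nT').
set d := y n.+2 - y n.+1.
have := ip_cs_abs normE (g n.+1 i) d; rewrite ler_norml => /andP[+ _].
have := ler_wpM2r (normr_ge0 d) (g_le i nT').
have : W n.+1 i + h i (y n.+1) + ip (g n.+1 i) d <=
  Num.max (W n.+1 i + h i (y n.+1) + ip (g n.+1 i) d)
    (pospart (- h i (y n.+2))) by rewrite le_max lexx.
lra.
Qed.

Lemma Q_sum n : (0 < n <= T)%N -> \sum_(1 <= t < n.+1) (y t - x t) = Q n.
Proof.
elim: n => // -[|n] ih nT; first by rewrite big_nat1 y1 subrr Q1.
have nT' : (0 < n.+1 < T)%N by [].
have {}ih := ih (ltnW nT' : (0 < n.+1 <= T)%N).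
by rewrite big_nat_recr//= ih (QS nT') addrA.
Qed.

Let xbar := T%:R^-1 *: \sum_(1 <= t < T.+1) x t.

(** The bound on the violation combines [bounded_subgradient_avg] at the average
    with [W_sum_le]; the last term [h i (y T)] of the sum is compared with
    [h i z <= 0], whence the distance [r] to [z].  For the second inequality, the
    subgradient of [f] at the average and the Lagrange multiplier bound the sum of the
    [f (y t) - f z] from below, with an error [L * r] for the last index, which is
    missing from the sum in [potential_le]. *)
Lemma trajectory_bound : exists q w r rho : R,
  [/\ [/\ 0 <= q, 0 <= w, 0 <= r & 0 <= rho],
   T%:R * norm2 (fun i => pospart (h i xbar)) <= w + G * (r + q + rho) &
   eta / 2 * q ^+ 2 + beta / 2 * w ^+ 2 + gam / 2 * r ^+ 2
   + beta * G ^+ 2 / 2 * (rho ^+ 2 / T%:R)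
   <= gam / 2 * D ^+ 2
      + T%:R * (eta * (D ^+ 2 + 2 * delta) / 2 + L ^+ 2 / (2 * alpha))
      + L * (q + r) + norm2 mu * (w + G * (r + q + rho))
      + \sum_(1 <= t < T) run_noise t].
Proof.
pose wi i := W T i - pospart (- h i (y T)).
pose q := `|Q T|; pose w := norm2 wi; pose r := `|y T - z|.
pose rho := \sum_(1 <= t < T) `|y t.+1 - y t|.
have TT : (0 < T <= T)%N by rewrite T0 leqnn.
have q0 : 0 <= q by exact: normr_ge0.
have r0 : 0 <= r by exact: normr_ge0.
have rho0 : 0 <= rho by exact: sumr_ge0.
have w0 : 0 <= w by exact: norm2_ge0.
have wi0 i : 0 <= wi i by rewrite subr_ge0 W_ge.
have Xbar : X xbar by exact: convex_average.
have Ybar := subXY Xbar.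
have QE : \sum_(1 <= t < T.+1) (y t - xbar) = Q T.
  rewrite -(Q_sum TT) !sumrB; congr (_ - _).
  rewrite big_const_nat iter_addr_0 subSS subn0 -scaler_nat /xbar scalerA.
  by rewrite divff ?scale1r// pnatr_eq0 -lt0n.
have hbar i : T%:R * h i xbar <= wi i + Gi i * (r + q + rho).
  have := bounded_subgradient_avg normE (subh i) Ybar QE.
  rewrite (big_nat_recr T)//=; have := W_sum_le i TT.
  have := bounded_subgradient_lip normE z (subh i) (Yy TT).
  rewrite -/q -/r -/rho; have := hz i.
  have : h i (y T) <= pospart (h i (y T)) by exact: ge_pospart.
  have : pospart (h i (y T)) - pospart (- h i (y T)) = h i (y T).
    rewrite /pospart; case: (leP 0 (h i (y T))); case: (leP 0 (- h i (y T))); lra.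
  have : 0 <= Gi i * r by rewrite mulr_ge0.
  rewrite /wi /pospart; case: (leP 0 (h i (y T))); lra.
have rq0 : 0 <= r + q + rho by rewrite !addr_ge0.
exists q, w, r, rho; split => //.
  have -> : T%:R * norm2 (fun i => pospart (h i xbar))
      = norm2 (fun i => pospart (T%:R * h i xbar)).
    rewrite /norm2 -[X in X * _](@ger0_norm _ T%:R)// -sqrtr_sqr -sqrtrM ?sqr_ge0//.
    rewrite mulr_sumr; congr Num.sqrt; apply: eq_bigr => i _.
    by rewrite -exprMn /pospart maxr_pMr// mulr0.
  apply: (norm2_le G0 rq0 sumG) => i; rewrite pospart_ge0/= /pospart.
  by rewrite ge_max hbar addr_ge0// mulr_ge0.
have := potential_le TT; rewrite big_split/= -mulr_sumr sumrB.
have omega_ge : w ^+ 2 <= omega T.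
  rewrite norm2E; apply: ler_sum => i _.
  have := W_ge i TT; have := pospart_ge0 (- h i (y T)); rewrite /wi.
  set a := W T i; set b := pospart _ => b0 ba.
  by have := mulr_ge0 b0 (_ : 0 <= a - b); rewrite subr_ge0 => /(_ ba); lra.
(* Cauchy-Schwarz, as the nonnegativity of the variance of the step lengths. *)
have rho2 : rho ^+ 2 / T%:R <= \sum_(1 <= t < T) `|y t.+1 - y t| ^+ 2.
  pose k := rho / T%:R.
  have rhoE : rho = k * T%:R by rewrite divfK// pnatr_eq0 -lt0n.
  have -> : rho ^+ 2 / T%:R = k * rho by rewrite /k; ring.
  have : 0 <= \sum_(1 <= t < T) (`|y t.+1 - y t| - k) ^+ 2.
    by apply: sumr_ge0 => t _; exact: sqr_ge0.
  under eq_bigr do rewrite sqrrB.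
  rewrite big_split/= sumrB big_const_nat iter_addr_0 -mulr_natl natrB//.
  rewrite [X in _ - X]sumrMnl -mulr_suml -/rho.
  have := sqr_ge0 k; rewrite rhoE; lra.
have fbar := bounded_subgradient_avg normE subf Ybar QE.
rewrite (big_nat_recr T)//= in fbar.
have flip := bounded_subgradient_lip normE z subf (Yy TT).
have mub : \sum_(i < m) mu i * (T%:R * h i xbar)
    <= norm2 mu * (w + G * (r + q + rho)).
  apply: (@le_trans _ _ (\sum_(i < m) (mu i * wi i + (r + q + rho) * (mu i * Gi i)))).
    by apply: ler_sum => i _; have := ler_wpM2l (mu0 i) (hbar i); lra.
  rewrite big_split/= -mulr_sumr.
  have := @sum_mul_le _ _ (norm2 mu) w mu wi.
  rewrite !norm2E !norm2_ge0 !lexx => /(_ isT isT isT isT).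
  have := @sum_mul_le _ _ (norm2 mu) G mu Gi.
  rewrite !norm2E !norm2_ge0 !lexx => /(_ isT G0 isT sumG)/(ler_wpM2l rq0).
  lra.
have lagT : T%:R * f z <= T%:R * f xbar + \sum_(i < m) mu i * (T%:R * h i xbar).
  have := ler_wpM2l (ler0n R T) (lagr Xbar); rewrite mulrDr mulr_sumr.
  by under eq_bigr do rewrite mulrCA.
have beta20 : 0 <= beta / 2 by rewrite divr_ge0// ltW.
have := ler_wpM2l beta20 omega_ge.
have := ler_wpM2l (mulr_ge0 beta20 (sqr_ge0 G)) rho2.
have -> : \sum_(1 <= t < T) f z = (T%:R - 1) * f z.
  by rewrite big_const_nat iter_addr_0 -(mulr_natl (f z)) (natrB _ T0).
rewrite /potential -/q -/r; move: mub lagT flip fbar; rewrite -/q -/r; lra.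
Qed.

End trajectory.

(** * From the trajectory inequality to rates *)

Section tradeoff.
Variable R : realType.
Implicit Types (B K N U : R).

(** Half of [N] absorbs [l] and [M * U], the latter because [U ^+ 2 <= K * N].
    What remains bounds [U ^+ 2] by [B ^+ 2 + 2 * K * Z], and
    [2 * B * U <= B ^+ 2 + U ^+ 2] makes it linear in [Z]. *)
Lemma quadratic_tradeoff (N C1 l C2 M U K Z B : R) : 0 < K -> 0 < B ->
  N <= C1 + l + M * U + Z -> l <= N / 4 + C2 -> U ^+ 2 <= K * N ->
  2 * K * (C1 + C2 + K * M ^+ 2) <= B ^+ 2 ->
  U <= B + K / B * Z.
Proof.
move=> K0 B0 hN hl hU hB.
have hMU : M * U <= N / 4 + K * M ^+ 2.
  rewrite -(ler_pM2l (_ : 0 < 4 * K)); last by rewrite mulr_gt0.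
  have := sqr_ge0 (U - 2 * K * M); lra.
have hN2 : N <= 2 * (C1 + C2 + K * M ^+ 2) + 2 * Z by lra.
have {}hN2 := ler_wpM2l (ltW K0) hN2.
have hBU : 2 * B * U <= 2 * B * (B + K / B * Z).
  have -> : 2 * B * (B + K / B * Z) = 2 * B ^+ 2 + 2 * K * Z.
    by field; rewrite gt_eqF.
  have := sqr_ge0 (U - B); lra.
by rewrite ler_pM2l// mulr_gt0 in hBU.
Qed.

(** All the lengths are measured in units of [k = T * eps]: after division
    by [k], the left side dominates half of
    [q' ^+ 2 + w' ^+ 2 + r' ^+ 2 + G ^+ 2 * rho' ^+ 2], since [1 <= T * eps ^+ 2] and
    [1 <= T], and nothing but [Z / k] depends on [eps] or [T] on the right.  The constants
    are those of [quadratic_tradeoff] with [K = 4 * (1 + G ^+ 2)]. *)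
Lemma accuracy_bound (D delta L G M eps B v q w r rho Z : R) (T : nat) :
  let A := D ^+ 2 + 2 * delta in
  0 <= delta -> 0 <= L -> 0 <= G -> 0 <= M -> 0 < eps -> 1 / eps ^+ 2 <= T%:R ->
  0 < B ->
  8 * (1 + G ^+ 2) * (A / 2 + (1 + 2 * G ^+ 2) * D ^+ 2 / 2 + L ^+ 2 / 2
    + 4 * L ^+ 2 + 4 * (1 + G ^+ 2) * M ^+ 2) <= B ^+ 2 ->
  T%:R * v <= w + G * (r + q + rho) ->
  eps / 2 * q ^+ 2 + 1 / eps / 2 * w ^+ 2
   + (1 / eps + 2 * G ^+ 2 * (1 / eps)) / 2 * r ^+ 2
   + 1 / eps * G ^+ 2 / 2 * (rho ^+ 2 / T%:R)
   <= (1 / eps + 2 * G ^+ 2 * (1 / eps)) / 2 * D ^+ 2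
      + T%:R * (eps * A / 2 + L ^+ 2 / (2 * (1 / eps)))
      + L * (q + r) + M * (w + G * (r + q + rho)) + Z ->
  v <= eps * B + 4 * (1 + G ^+ 2) / (B * T%:R) * Z.
Proof.
move=> A d0 L0 G0 M0 e0 eT B0 hB hv hP.
have T0 : 0 < T%:R :> R by rewrite (lt_le_trans _ eT)// divr_gt0// exprn_gt0.
have eT1 : 1 <= T%:R * eps ^+ 2 by rewrite -ler_pdivrMr// exprn_gt0.
pose k := T%:R * eps; have k0 : 0 < k by exact: mulr_gt0.
have kn : k != 0 by rewrite gt_eqF.
have en : eps != 0 by rewrite gt_eqF.
have Tn : T%:R != 0 :> R by rewrite gt_eqF.
have hat (a : R) : a = k * (a / k) by rewrite mulrC divfK.
move: hv hP; rewrite (hat q) (hat w) (hat r) (hat rho).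
set q' := q / k; set w' := w / k; set r' := r / k; set rho' := rho / k => hv hP.
set U := w' + G * (r' + q' + rho').
pose N := (q' ^+ 2 + w' ^+ 2 + r' ^+ 2 + G ^+ 2 * rho' ^+ 2) / 2.
have hU : U <= B + 4 * (1 + G ^+ 2) / B * (Z / k).
  apply: (@quadratic_tradeoff N
    (A / 2 + (1 + 2 * G ^+ 2) * D ^+ 2 / 2 + L ^+ 2 / 2) (L * (q' + r'))
    (4 * L ^+ 2) M) => //.
  - by rewrite mulr_gt0// ltr_pwDl// sqr_ge0.
  - rewrite -(ler_pM2l k0).
    have G2 := sqr_ge0 G; have D2 := sqr_ge0 D.
    have D2G : 0 <= (1 + 2 * G ^+ 2) * D ^+ 2 / 2.
      by rewrite divr_ge0// mulr_ge0// addr_ge0// mulr_ge0.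
    have h1 : k * (q' ^+ 2 / 2) <= eps / 2 * (k * q') ^+ 2.
      have -> : eps / 2 * (k * q') ^+ 2 = k * (q' ^+ 2 / 2) * (T%:R * eps ^+ 2).
        by rewrite /k; ring.
      by rewrite ler_peMr// mulr_ge0 ?(ltW k0)// divr_ge0// sqr_ge0.
    have T1 : 1 <= T%:R :> R by move: T0; rewrite ltr0n ler1n.
    have hw : k * (w' ^+ 2 / 2) <= 1 / eps / 2 * (k * w') ^+ 2.
      have -> : 1 / eps / 2 * (k * w') ^+ 2 = k * (w' ^+ 2 / 2) * T%:R.
        by rewrite /k; field.
      by rewrite ler_peMr// mulr_ge0 ?(ltW k0)// divr_ge0// sqr_ge0.
    have hr : k * (r' ^+ 2 / 2)
        <= (1 / eps + 2 * G ^+ 2 * (1 / eps)) / 2 * (k * r') ^+ 2.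
      have -> : (1 / eps + 2 * G ^+ 2 * (1 / eps)) / 2 * (k * r') ^+ 2
          = k * (r' ^+ 2 / 2) * (T%:R * (1 + 2 * G ^+ 2)).
        by rewrite /k; field.
      have kr0 : 0 <= k * (r' ^+ 2 / 2).
        by rewrite mulr_ge0 ?(ltW k0)// divr_ge0// sqr_ge0.
      rewrite ler_peMr//.
      by have := ler_wpM2r G2 T1; lra.
    have hrho : 1 / eps * G ^+ 2 / 2 * ((k * rho') ^+ 2 / T%:R)
        = k * (G ^+ 2 * rho' ^+ 2 / 2).
      by rewrite /k; field; rewrite Tn en.
    have hD : (1 / eps + 2 * G ^+ 2 * (1 / eps)) / 2 * D ^+ 2
        <= k * ((1 + 2 * G ^+ 2) * D ^+ 2 / 2).
      have -> : (1 / eps + 2 * G ^+ 2 * (1 / eps)) / 2 * D ^+ 2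
          = 1 / eps * ((1 + 2 * G ^+ 2) * D ^+ 2 / 2) by field.
      apply: ler_wpM2r => //; rewrite ler_pdivrMr//; move: eT1; rewrite /k; lra.
    have hA : T%:R * (eps * A / 2 + L ^+ 2 / (2 * (1 / eps)))
        = k * (A / 2 + L ^+ 2 / 2) by rewrite /k; field.
    have hZ : k * (Z / k) = Z by rewrite mulrC divfK.
    move: hP; rewrite hrho hA; set mD := _ / 2 * D ^+ 2 in hD *.
    have -> : k * (A / 2 + (1 + 2 * G ^+ 2) * D ^+ 2 / 2 + L ^+ 2 / 2
       + L * (q' + r') + M * U + Z / k) = k * (A / 2 + L ^+ 2 / 2)
       + k * ((1 + 2 * G ^+ 2) * D ^+ 2 / 2) + k * (L * (q' + r') + M * U) + Z.
      by rewrite -{2}hZ; ring.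
    rewrite /U /N; lra.
  - rewrite /N; have := sqr_ge0 (q' - 4 * L); have := sqr_ge0 (r' - 4 * L).
    have := sqr_ge0 w'; have := mulr_ge0 (sqr_ge0 G) (sqr_ge0 rho'); lra.
  (* Lagrange's identity for the vectors [(1, G, G, 1)] and [(w', r', q', G rho')]. *)
  - rewrite /U /N.
    have := sqr_ge0 (r' - G * w'); have := sqr_ge0 (q' - G * w').
    have := sqr_ge0 (G * rho' - w'); have := sqr_ge0 (G * q' - G * r').
    have := sqr_ge0 (G * (G * rho') - r').
    have := sqr_ge0 (G * (G * rho') - q'); lra.
  - by move: hB; lra.
rewrite -(ler_pM2l T0).
have -> : T%:R * (eps * B + 4 * (1 + G ^+ 2) / (B * T%:R) * Z)
    = k * (B + 4 * (1 + G ^+ 2) / B * (Z / k)).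
  by rewrite /k; field; rewrite ?Tn ?en ?gt_eqF.
by have := ler_wpM2l (ltW k0) hU; move: hv; rewrite /U; lra.
Qed.

(** Cauchy-Schwarz for two terms with weights [p] and [r]. *)
Lemma sqrD_le (p r a b x y : R) : 0 < p -> 0 < r ->
  a ^+ 2 <= p * x -> b ^+ 2 <= r * y -> (a + b) ^+ 2 <= (p + r) * (x + y).
Proof.
move=> p0 r0 ax bY.
have : 2 * (a * b) <= r * x + p * y.
  rewrite -(ler_pM2l (mulr_gt0 p0 r0)).
  have := ler_wpM2l (sqr_ge0 r) ax; have := ler_wpM2l (sqr_ge0 p) bY.
  have := sqr_ge0 (r * a - p * b); lra.
lra.
Qed.

(** Here [n] is the square root of the horizon, and lengths are measured in units
    of [n].  The term [L * r'] is absorbed by the part [L * n / D] of the coefficient of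
    [r' ^+ 2]; the other three coefficients, and the part of this one proportional to
    [G / D], give [K] as the sum of the weights of the Cauchy-Schwarz inequality for
    [U]. *)
Lemma rate_bound (D delta L G M hx n v q w r rho Z : R) :
  let S := Num.sqrt (D ^+ 2 + 2 * delta) in
  let B := Num.sqrt (coefA0 L G D delta hx + coefA1 L G D delta * M
                     + coefA2 L G D delta * M ^+ 2) in
  let K := 5 * G * D + 2 * S * G ^+ 2 / L in
  0 <= delta -> 0 < L -> 0 < G -> 0 < D -> 0 <= M -> 1 <= n ->
  0 <= w -> 0 <= r ->
  n ^+ 2 * v <= w + G * (r + q + rho) ->
  L / (n * S) / 2 * q ^+ 2 + n / (G * D) / 2 * w ^+ 2
   + (L * n / D + 2 * G ^+ 2 * (n / (G * D))) / 2 * r ^+ 2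
   + n / (G * D) * G ^+ 2 / 2 * (rho ^+ 2 / n ^+ 2)
   <= (L * n / D + 2 * G ^+ 2 * (n / (G * D))) / 2 * D ^+ 2
      + n ^+ 2 * (L / (n * S) * (D ^+ 2 + 2 * delta) / 2
                  + L ^+ 2 / (2 * (L * n / D)))
      + L * (q + r) + M * (w + G * (r + q + rho)) + Z ->
  v <= n^-1 * B + K / (B * n ^+ 2) * Z.
Proof.
move=> S B K d0 L0 G0 D0 M0 n1 w0 r0 hv hP.
have n0 : 0 < n by exact: lt_le_trans n1.
have S2 : S ^+ 2 = D ^+ 2 + 2 * delta.
  by rewrite sqr_sqrtr// addr_ge0 ?sqr_ge0// mulr_ge0.
have S0 : 0 < S by rewrite sqrtr_gt0 ltr_pwDl ?exprn_gt0// mulr_ge0.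
have nn : n != 0 by rewrite gt_eqF.
have Sn : S != 0 by rewrite gt_eqF.
have Ln : L != 0 by rewrite gt_eqF.
have Gn : G != 0 by rewrite gt_eqF.
have Dn : D != 0 by rewrite gt_eqF.
have K0 : 0 < K.
  by rewrite addr_gt0 ?mulr_gt0 ?invr_gt0// exprn_gt0.
pose C1 := L * S / 2 + 3 * L * D / 2 + G * D.
have C10 : 0 < C1 by rewrite !addr_gt0 ?mulr_gt0.
pose B2 := coefA0 L G D delta hx + coefA1 L G D delta * M
                     + coefA2 L G D delta * M ^+ 2.
have hB2 : 2 * K * (C1 + 2 * L * S + K * M ^+ 2) <= B2.
  rewrite /B2 /coefA0 /coefA1 /coefA2 -/S -S2 /K /C1.
  (* In terms of [a] and [b] both sides are polynomials, and the difference has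
     nonnegative coefficients. *)
  pose a := G / L; pose b := S / D.
  have a0 : 0 < a by exact: divr_gt0.
  have b0 : 0 < b by exact: divr_gt0.
  have -> : G = a * L by rewrite divfK.
  have -> : 2 * S * (a * L) ^+ 2 / L = 2 * S * a ^+ 2 * L by field.
  have -> : (a * L) ^+ 3 / L = a ^+ 3 * L ^+ 2 by field.
  have -> : (a * L) ^+ 4 / L ^+ 2 = a ^+ 4 * L ^+ 2 by field.
  have -> : a * L / L = a by field.
  rewrite -/b.
  pose pos (u v : R) := mulr_ge0 (sqr_ge0 u) (sqr_ge0 v).
  have LL := sqr_ge0 L; have aa := sqr_ge0 a; have MM := sqr_ge0 M.
  have DS : 0 <= D * S by rewrite ltW// mulr_gt0.
  have aL : 0 <= a * L ^+ 2 by rewrite mulr_ge0// ltW.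
  have aaL : 0 <= a ^+ 2 * L ^+ 2 by rewrite mulr_ge0.
  have aaaL : 0 <= a ^+ 3 * L ^+ 2 by rewrite mulr_ge0// ltW// exprn_gt0.
  have aaaaL : 0 <= a ^+ 4 * L ^+ 2 by rewrite mulr_ge0// ltW// exprn_gt0.
  have SS := sqr_ge0 S; have DD := sqr_ge0 D.
  have := mulr_ge0 aL DD; have := mulr_ge0 aL DS.
  have := mulr_ge0 aaL DD; have := mulr_ge0 aaL SS; have := mulr_ge0 aaL DS.
  have := mulr_ge0 aaaL DS; have := mulr_ge0 (mulr_ge0 aaaL DS) MM.
  have := mulr_ge0 (mulr_ge0 aaL DD) MM; have := mulr_ge0 (mulr_ge0 aaaaL SS) MM.
  have := mulr_ge0 (mulr_ge0 aaaL SS) M0; have := mulr_ge0 (mulr_ge0 aaL DS) M0.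
  have := sqr_ge0 hx.
  have := mulr_ge0 (sqr_ge0 hx) (mulr_ge0 (ltW a0) (ltW b0)).
  lra.
have B20 : 0 < B2.
  apply: lt_le_trans hB2; rewrite mulr_gt0 ?mulr_gt0// ltr_pwDl ?mulr_ge0 ?sqr_ge0//.
    by rewrite addr_gt0 ?mulr_gt0.
  exact: ltW.
have BE : B ^+ 2 = B2 by rewrite sqr_sqrtr// ltW.
have B0 : 0 < B by rewrite sqrtr_gt0.
have hat (a : R) : a = n * (a / n) by rewrite mulrC divfK.
move: hv hP w0 r0; rewrite (hat q) (hat w) (hat r) (hat rho).
set q' := q / n; set w' := w / n; set r' := r / n; set rho' := rho / n.
move=> hv hP w0 r0.
set U := w' + G * (r' + q' + rho').
pose N := L / (2 * S) * q' ^+ 2 + 1 / (2 * (G * D)) * w' ^+ 2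
  + G / D * r' ^+ 2 + G / (2 * D) * rho' ^+ 2.
have hU : U <= B + K / B * (Z / n).
  apply: (@quadratic_tradeoff N C1 (L * q') (2 * L * S) M) => //.
  (* The trajectory inequality divided by [n]. *)
  - rewrite -(ler_pM2l n0).
    have n21 : 1 <= n ^+ 2 by rewrite exprn_ege1.
    have hq : L / (n * S) / 2 * (n * q') ^+ 2 = n * (L / (2 * S) * q' ^+ 2).
      by field; rewrite nn Sn.
    have hw : n * (1 / (2 * (G * D)) * w' ^+ 2) <= n / (G * D) / 2 * (n * w') ^+ 2.
      have -> : n / (G * D) / 2 * (n * w') ^+ 2
          = n * (1 / (2 * (G * D)) * w' ^+ 2) * n ^+ 2.
        by field; rewrite Gn Dn.
      rewrite ler_peMr// mulr_ge0 ?(ltW n0)// mulr_ge0 ?sqr_ge0//.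
      by rewrite divr_ge0// ltW// !mulr_gt0.
    have hr : n * ((L / (2 * D) + G / D) * r' ^+ 2)
        <= (L * n / D + 2 * G ^+ 2 * (n / (G * D))) / 2 * (n * r') ^+ 2.
      have -> : (L * n / D + 2 * G ^+ 2 * (n / (G * D))) / 2 * (n * r') ^+ 2
          = n * ((L / (2 * D) + G / D) * r' ^+ 2) * n ^+ 2.
        by field; rewrite Gn Dn.
      rewrite ler_peMr// mulr_ge0 ?(ltW n0)// mulr_ge0 ?sqr_ge0//.
      by rewrite ltW// addr_gt0// divr_gt0// mulr_gt0.
    have hrho : n / (G * D) * G ^+ 2 / 2 * ((n * rho') ^+ 2 / n ^+ 2)
        = n * (G / (2 * D) * rho' ^+ 2).
      by field; rewrite nn Gn Dn.
    have hD : (L * n / D + 2 * G ^+ 2 * (n / (G * D))) / 2 * D ^+ 2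
        = n * (L * D / 2 + G * D).
      by field; rewrite Gn Dn.
    have hA : n ^+ 2 * (L / (n * S) * (D ^+ 2 + 2 * delta) / 2
                  + L ^+ 2 / (2 * (L * n / D))) = n * (L * S / 2 + L * D / 2).
      by rewrite -S2; field; rewrite nn Sn Ln Dn.
    have hLr : n * (L * r') <= n * (L / (2 * D) * r' ^+ 2 + L * D / 2).
      apply: ler_wpM2l; first exact: ltW.
      have -> : L / (2 * D) * r' ^+ 2 + L * D / 2
          = L / (2 * D) * (r' - D) ^+ 2 + L * r' by field.
      by rewrite lerDr mulr_ge0 ?sqr_ge0// divr_ge0// ltW// mulr_gt0.
    have -> : n * (C1 + L * q' + M * U + Z / n)
        = n * C1 + n * (L * q') + n * (M * U) + Z.
      by field.
    move: hP; rewrite hq hrho hD hA.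
    move: hr hw hLr; set iGD := 1 / (2 * (G * D)); set iD := L / (2 * D).
    set iD' := G / D; set iD'' := G / (2 * D); set iS := L / (2 * S).
    rewrite /N /C1 /U -/iGD -/iD' -/iD'' -/iS.
    set m1 := _ / 2 * (n * w') ^+ 2; set m2 := _ / 2 * (n * r') ^+ 2.
    lra.
  - have hq : L * q' = L / (2 * S) * q' ^+ 2 / 4 + 2 * L * S
        - L / (8 * S) * (q' - 4 * S) ^+ 2 by field.
    have h1 : 0 <= L / (8 * S) * (q' - 4 * S) ^+ 2.
      by rewrite mulr_ge0 ?sqr_ge0// divr_ge0// ltW// mulr_gt0.
    have h2 : 0 <= 1 / (2 * (G * D)) * w' ^+ 2.
      by rewrite mulr_ge0 ?sqr_ge0// divr_ge0// ltW// !mulr_gt0.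
    have h3 : 0 <= G / D * r' ^+ 2.
      by rewrite mulr_ge0 ?sqr_ge0// divr_ge0// ltW.
    have h4 : 0 <= G / (2 * D) * rho' ^+ 2.
      by rewrite mulr_ge0 ?sqr_ge0// divr_ge0// ltW// mulr_gt0.
    by rewrite hq /N; lra.
  - have -> : U = (w' + G * r') + (G * q' + G * rho') by rewrite /U; ring.
    have -> : K = (2 * (G * D) + G * D) + (2 * S * G ^+ 2 / L + 2 * (G * D)).
      by rewrite /K; ring.
    have -> : N = (1 / (2 * (G * D)) * w' ^+ 2 + G / D * r' ^+ 2)
        + (L / (2 * S) * q' ^+ 2 + G / (2 * D) * rho' ^+ 2) by rewrite /N; ring.
    have GD0 : 0 < G * D by exact: mulr_gt0.
    have GD20 : 0 < 2 * (G * D) by exact: mulr_gt0.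
    have SGL0 : 0 < 2 * S * G ^+ 2 / L by rewrite divr_gt0 ?mulr_gt0 ?exprn_gt0.
    apply: sqrD_le; rewrite ?addr_gt0//; apply: sqrD_le => //;
      rewrite le_eqVlt; apply/orP; left; apply/eqP; field; by rewrite ?Gn ?Dn ?Sn ?Ln.
  - by rewrite BE.
rewrite -(ler_pM2l (_ : 0 < n ^+ 2)) ?exprn_gt0//.
have -> : n ^+ 2 * (n^-1 * B + K / (B * n ^+ 2) * Z) = n * (B + K / B * (Z / n)).
  by field; rewrite ?nn ?gt_eqF.
by have := ler_wpM2l (ltW n0) hU; move: hv; rewrite /U; lra.
Qed.

End tradeoff.

(** * Disintegration along a kernel *)

Section graph_kernel.
Context (R : realType) (d1 d2 d3 : measure_display) (E : measurableType d1)
  (S : measurableType d2) (O : measurableType d3).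
Variables (k : R.-pker E ~> O) (q : S -> E).

Definition pullback_kernel of measurable_fun setT q :
  S -> {measure set O -> \bar R} := fun s => k (q s).

Hypothesis mq : measurable_fun setT q.

Let measurable_pullback U : measurable U ->
  measurable_fun [set: S] (fun s => (pullback_kernel mq) s U : \bar R).
Proof. by move=> mU; exact: measurableT_comp (measurable_kernel k U mU) mq. Qed.

HB.instance Definition _ := isKernel.Build _ _ _ _ _ (pullback_kernel mq)
  measurable_pullback.

Let pullback_prob s : (pullback_kernel mq) s [set: O] = 1%E.
Proof. exact: prob_kernel. Qed.

HB.instance Definition _ := Kernel_isProbability.Build _ _ _ _ _
  (pullback_kernel mq) pullback_prob.

Definition graph_at (s : S) (o : O) : S * O := (s, o).

Lemma measurable_graph_at (s : S) : measurable_fun [set: O] (graph_at s).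
Proof. exact: measurable_fun_pair. Qed.

(** The law of [(s, o)] when [o] is drawn at [q s].  The factor [unit] gives the
    source the product form expected by the composition of kernels. *)
Definition graph_kernel (us : unit * S) : {measure set (S * O) -> \bar R} :=
  measure_function_pushforward__canonical__measure_function_Measure
    (pullback_kernel mq us.2) (measurable_graph_at us.2).

Let measurable_graph U : measurable U ->
  measurable_fun [set: unit * S] (fun us => graph_kernel us U : \bar R).
Proof.
move=> mU.
have mx := @measurable_fun_xsection_finite_kernel _ _ _ _ _
  (pullback_kernel mq) _ (mem_set mU).
rewrite (_ : (fun us => _) =
    (fun s => pullback_kernel mq s (xsection U s)) \o @snd unit S).
  exact: measurableT_comp mx _.
apply/funext => -[u s] /=; congr (pullback_kernel mq s _).
by apply/seteqP; split => o /=; rewrite /xsection /= inE.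
Qed.

HB.instance Definition _ := isKernel.Build _ _ _ _ _ graph_kernel
  measurable_graph.

Let graph_prob us : graph_kernel us [set: S * O] = 1%E.
Proof. exact: (@prob_kernel _ _ _ _ _ (pullback_kernel mq)). Qed.

HB.instance Definition _ := Kernel_isProbability.Build _ _ _ _ _
  graph_kernel graph_prob.

Lemma measurable_graph_integral (phi : S * O -> \bar R) :
  measurable_fun setT phi -> (forall x, 0 <= phi x)%E ->
  measurable_fun setT (fun s => \int[graph_kernel (tt, s)]_x phi x)%E.
Proof.
move=> mphi phi0; apply: (@measurable_fun_integral_kernel _ _ _ _ _
  (fun s => graph_kernel (tt, s))) => // U mU.
exact: measurableT_comp (measurable_kernel graph_kernel _ mU) _.
Qed.

End graph_kernel.

Section disintegration.
Context (R : realType) (d d1 d2 d3 : measure_display) (Omega : measurableType d)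
  (E : measurableType d1) (S : measurableType d2) (O : measurableType d3).
Variables (P : probability Omega R) (k : R.-pker E ~> O) (q : S -> E).
Variables (p : Omega -> S) (Z : Omega -> O).
Hypotheses (mq : measurable_fun setT q) (mp : measurable_fun setT p)
  (mZ : measurable_fun setT Z).
Hypothesis condZ : forall A B, measurable A -> measurable B ->
  P (p @^-1` A `&` Z @^-1` B) = (\int[P]_(w in p @^-1` A) k (q (p w)) B)%E.

Let mpZ : measurable_fun setT (fun w => (p w, Z w)).
Proof. exact: measurable_fun_pair. Qed.

Let lawp : {measure set S -> \bar R} :=
  measure_function_pushforward__canonical__measure_function_Measure P mp.
Let lawpZ : {measure set (S * O) -> \bar R} :=
  measure_function_pushforward__canonical__measure_function_Measure P mpZ.

Let l (_ : unit) := lawp.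

Let ml U : measurable U -> measurable_fun [set: unit] (fun s => l s U : \bar R).
Proof. by move=> mU; exact: measurable_cst. Qed.

HB.instance Definition _ := isKernel.Build _ _ _ _ _ l ml.

Let l_prob s : l s [set: S] = 1%E.
Proof. exact: (@probability_setT _ _ _ P). Qed.

HB.instance Definition _ := Kernel_isProbability.Build _ _ _ _ _ l l_prob.

(* The type [unit] serves as the source of a kernel that is a single measure. *)
Let joint : {measure set (S * O) -> \bar R} := mkcomp l (graph_kernel k mq) tt.

Let joint_rect A B : measurable A -> measurable B ->
  joint (A `*` B) = lawpZ (A `*` B).
Proof.
move=> mA mB; rewrite /joint /= /kcomp.
rewrite (ge0_integral_pushforward mp)//; last first.
  exact: measurableT_comp (measurable_kernel (graph_kernel k mq) _
    (measurableX mA mB)) _.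
rewrite preimage_setT /lawpZ /= /pushforward.
transitivity (P (p @^-1` A `&` Z @^-1` B)); last by congr (P _).
rewrite condZ// [RHS]integral_mkcond; apply: eq_integral => w _ /=.
rewrite patchE /graph_kernel /= /pushforward /graph_at /=.
case: ifPn => [|]; rewrite ?inE/= ?notin_setE /= => pA.
  by congr (k _ _); apply/seteqP; split => o /= // -[].
rewrite -[RHS](measure0 (k (q (p w)))); congr (k _ _).
by apply/seteqP; split => o //= -[].
Qed.

Let jointE A : measurable A -> joint A = lawpZ A.
Proof.
pose C : set (set (S * O)) :=
  [set C | exists A, measurable A /\ exists B, measurable B /\ C = A `*` B].
move=> mA; apply: (measure_unique C (fun=> setT)) => //.
- rewrite measurable_prod_measurableType //; congr (<<s _ >>).
  rewrite predeqE; split => [[A1 mA1 [B mB <-]]|[A1 [mA1 [B [mB ->]]]]].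
    by exists A1; split => //; exists B.
  by exists A1 => //; exists B.
- move=> _ _ [A1 [mA1 [A2 [mA2 ->]]]] [B1 [mB1 [B2 [mB2 ->]]]].
  rewrite -setXI; exists (A1 `&` B1); split; first exact: measurableI.
  by exists (A2 `&` B2); split => //; exact: measurableI.
- by move=> _; exists setT; split => //; exists setT; split => //; rewrite setXTT.
- by rewrite bigcup_const.
- by move=> _ [A1 [mA1 [B1 [mB1 ->]]]]; exact: joint_rect.
- move=> _; rewrite -setXTT joint_rect// setXTT.
  by rewrite /lawpZ /= /pushforward preimage_setT probability_setT ltry.
Qed.

(** Both sides are integrals of [phi], for the joint law of [p] and [Z] and for the
    composition of the law of [p] with the kernel.  These two measures agree on
    rectangles by hypothesis, hence everywhere. *)
Lemma disintegration (phi : S * O -> \bar R) : measurable_fun setT phi ->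
  (forall x, 0 <= phi x)%E ->
  (\int[P]_w phi (p w, Z w) = \int[P]_w \int[k (q (p w))]_o phi (p w, o))%E.
Proof.
move=> mphi phi0.
have -> : (\int[P]_w phi (p w, Z w) = \int[lawpZ]_x phi x)%E.
  by rewrite /lawpZ/= (ge0_integral_pushforward mpZ).
have -> : (\int[lawpZ]_x phi x = \int[joint]_x phi x)%E.
  by apply: eq_measure_integral => A mA _; rewrite jointE.
rewrite /joint integral_kcomp// (ge0_integral_pushforward mp)//; last first.
- by move=> s _; exact: integral_ge0.
- exact: (measurable_graph_integral k mq).
rewrite preimage_setT; apply: eq_integral => w _ /=.
rewrite (ge0_integral_pushforward (measurable_graph_at (p w)))//.
Qed.

Lemma measurable_kernel_integral (phi : S * O -> \bar R) :
  measurable_fun setT phi -> (forall x, 0 <= phi x)%E ->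
  measurable_fun setT (fun w => \int[k (q (p w))]_o phi (p w, o))%E.
Proof.
move=> mphi phi0.
have := measurable_graph_integral k mq mphi phi0.
move=> /measurableT_comp/(_ mp); apply: eq_measurable_fun => w _ /=.
by rewrite (ge0_integral_pushforward (measurable_graph_at (p w))).
Qed.

Lemma conditional_integral_le (phi : S * O -> \bar R) (c : R) :
  measurable_fun setT phi -> (forall x, 0 <= phi x)%E ->
  (forall w, \int[k (q (p w))]_o phi (p w, o) <= c%:E)%E ->
  (\int[P]_w phi (p w, Z w) <= c%:E)%E.
Proof.
move=> mphi phi0 h; rewrite disintegration//.
apply: (@le_trans _ _ (\int[P]_w (cst c%:E w))%E).
  apply: ge0_le_integral => //.
  - by move=> w _; exact: integral_ge0.
  - exact: measurable_kernel_integral.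
rewrite integral_cst; last by [].
by rewrite [X in (_ * X)%E](@probability_setT _ _ _ P) mule1.
Qed.

(** The positive and negative parts are disintegrated separately, as only
    nonnegative functions can be without an integrability assumption; their conditional
    integrals are compared for each [w]. *)
Lemma conditional_integral_le0 (phi : S * O -> R) :
  measurable_fun setT phi ->
  (forall w, (k (q (p w))).-integrable setT (fun o => (phi (p w, o))%:E)) ->
  (forall w, \int[k (q (p w))]_o (phi (p w, o))%:E <= 0)%E ->
  P.-integrable setT (fun w => (phi (p w, Z w))%:E) ->
  (\int[P]_w (phi (p w, Z w))%:E <= 0)%E.
Proof.
move=> mphi kphi kphi0 Pphi.
have mEphi : measurable_fun setT (EFin \o phi) by exact/measurable_EFinP.
have pos0 x : (0 <= ((EFin \o phi)^\+ x))%E by exact: funepos_ge0.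
have neg0 x : (0 <= ((EFin \o phi)^\- x))%E by exact: funeneg_ge0.
have mpos := measurable_funepos mEphi.
have mneg := measurable_funeneg mEphi.
have posneg : (\int[P]_w ((EFin \o phi)^\+ (p w, Z w))
    <= \int[P]_w ((EFin \o phi)^\- (p w, Z w)))%E.
  rewrite disintegration// [leRHS]disintegration//.
  apply: ge0_le_integral => //.
  - by move=> w _; exact: integral_ge0.
  - exact: measurable_kernel_integral.
  - exact: measurable_kernel_integral.
  move=> w _; have fin := integrable_neg_fin_num measurableT (kphi w).
  have := kphi0 w; rewrite integralE leeBlDr// add0e.
  have := funepos_comp (EFin \o phi) (pair (p w)).
  have := funeneg_comp (EFin \o phi) (pair (p w)).
  by rewrite /comp /= => -> ->.
have fin := integrable_neg_fin_num measurableT Pphi.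
rewrite integralE leeBlDr// add0e.
have := funepos_comp (EFin \o phi) (fun w => (p w, Z w)).
have := funeneg_comp (EFin \o phi) (fun w => (p w, Z w)).
by move: posneg; rewrite /comp /= => posneg -> ->.
Qed.

End disintegration.

(** * Integrable and square-integrable functions *)

Section integrability.
Context (R : realType) (d : measure_display) (T : measurableType d).
Variable P : probability T R.
Implicit Types f g : T -> R.

Definition integr f := P.-integrable setT (EFin \o f).

Lemma integrD f g : integr f -> integr g -> integr (fun w => f w + g w).
Proof. by move=> fi gi; exact: (integrableD measurableT fi gi). Qed.

Lemma integrZ (c : R) f : integr f -> integr (fun w => c * f w).
Proof. by move=> fi; exact: (integrableZl measurableT c fi). Qed.

Lemma integrB f g : integr f -> integr g -> integr (fun w => f w - g w).
Proof. by move=> fi gi; exact: (integrableB measurableT fi gi). Qed.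

Lemma integr_cst (c : R) : integr (fun=> c).
Proof. exact: finite_measure_integrable_cst. Qed.

Lemma integr_ae_le f g : measurable_fun setT f -> integr g ->
  {ae P, forall w, `|f w| <= g w} -> integr f.
Proof.
move=> mf gi fg; apply/integrableP; split; first exact/measurable_EFinP.
have /integrableP[mg goo] := gi.
apply: le_lt_trans goo; apply: ae_ge0_le_integral => //.
- by apply: measurableT_comp => //; exact/measurable_EFinP.
- exact: measurableT_comp.
by apply: filterS fg => w fgw _; rewrite /= lee_fin (le_trans fgw)// ler_norm.
Qed.

Lemma integr_le f g : measurable_fun setT f -> integr g ->
  (forall w, `|f w| <= g w) -> integr f.
Proof. by move=> mf gi fg; apply: (integr_ae_le mf gi); exact: aeW. Qed.

Lemma integral_ae_le f g : integr f -> integr g ->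
  {ae P, forall w, f w <= g w} ->
  (\int[P]_w (f w)%:E <= \int[P]_w (g w)%:E)%E.
Proof.
move=> fi gi [N [mN N0 fgN]].
rewrite (negligible_integral mN measurableT fi N0).
rewrite (negligible_integral mN measurableT gi N0).
have sN (h : T -> R) : integr h -> P.-integrable (setT `\` N) (EFin \o h).
  by move=> hi; apply: (integrableS measurableT) => //; exact: measurableD.
apply: le_integral; [exact: measurableD|exact: sN|exact: sN|].
move=> w; rewrite inE => -[_ Nw] /=; rewrite lee_fin.
by apply: contrapT => fg; apply: Nw; exact: fgN.
Qed.

(** Integrability is part of the notion, so that it is stable under sums. *)
Definition nonpos_mean f := integr f /\ (\int[P]_w (f w)%:E <= 0)%E.

Lemma nonpos_meanD f g : nonpos_mean f -> nonpos_mean g ->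
  nonpos_mean (fun w => f w + g w).
Proof.
move=> [fi f0] [gi g0]; split; first exact: integrD.
under eq_integral do rewrite EFinD.
by rewrite (integralD_EFin measurableT fi gi) -[leRHS]adde0 leeD.
Qed.

Lemma nonpos_meanZ (c : R) f : 0 <= c -> nonpos_mean f ->
  nonpos_mean (fun w => c * f w).
Proof.
move=> c0 [fi f0]; split; first exact: integrZ.
under eq_integral do rewrite EFinM.
by rewrite (integralZl measurableT fi) mule_ge0_le0.
Qed.

Lemma nonpos_mean0 : nonpos_mean (fun=> 0).
Proof. by split; [exact: integr_cst|rewrite integral0]. Qed.

Lemma nonpos_mean_sum (I : eqType) (r : seq I) (f : I -> T -> R) :
  (forall i, i \in r -> nonpos_mean (f i)) ->
  nonpos_mean (fun w => \sum_(i <- r) f i w).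
Proof.
elim: r => [|i r ih] fi.
  by under eq_fun do rewrite big_nil; exact: nonpos_mean0.
under eq_fun do rewrite big_cons.
apply: nonpos_meanD; first by apply: fi; rewrite mem_head.
by apply: ih => j jr; apply: fi; rewrite in_cons jr orbT.
Qed.

(** The bridge from inequalities along trajectories to expectations. *)
Lemma integral_le_noise f g (b c : R) : integr f -> nonpos_mean g -> 0 <= c ->
  {ae P, forall w, f w <= b + c * g w} -> (\int[P]_w (f w)%:E <= b%:E)%E.
Proof.
move=> fi gn c0 fg; have [gi g0] := nonpos_meanZ c0 gn.
apply: (le_trans (integral_ae_le fi (integrD (integr_cst b) gi) fg)).
under eq_integral do rewrite EFinD.
rewrite (integralD_EFin measurableT (integr_cst b) gi) integral_cst//.
rewrite -[leRHS]adde0 leeD//.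
by rewrite [X in (_ * X)%E](@probability_setT _ _ _ P) mule1.
Qed.

Definition sq_integr f := measurable_fun setT f /\ integr (fun w => f w ^+ 2).

Lemma sq_integr_ae_le f g : measurable_fun setT f -> sq_integr g ->
  {ae P, forall w, `|f w| <= `|g w|} -> sq_integr f.
Proof.
move=> mf [mg gi] fg; split => //.
apply: (integr_ae_le _ gi); first exact: measurable_funX.
apply: filterS fg => w fgw; rewrite normrX -[leRHS](real_normK (num_real _)).
by rewrite lerXn2r ?nnegrE.
Qed.

Lemma sq_integr_le f g : measurable_fun setT f -> sq_integr g ->
  (forall w, `|f w| <= `|g w|) -> sq_integr f.
Proof. by move=> mf gi fg; apply: (sq_integr_ae_le mf gi); exact: aeW. Qed.

Lemma sq_integrD f g : sq_integr f -> sq_integr g ->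
  sq_integr (fun w => f w + g w).
Proof.
move=> [mf fi] [mg gi]; have mfg := measurable_funD mf mg; split => //.
apply: (integr_le _ (integrD (integrZ 2 fi) (integrZ 2 gi))).
  exact: measurable_funX.
move=> w /=; rewrite ger0_norm ?sqr_ge0//; have := sqr_ge0 (f w - g w); lra.
Qed.

Lemma sq_integrZ (c : R) f : sq_integr f -> sq_integr (fun w => c * f w).
Proof.
move=> [mf fi]; split; first exact: measurable_funM.
by under eq_fun do rewrite exprMn; exact: integrZ.
Qed.

Lemma sq_integr_cst (c : R) : sq_integr (fun=> c).
Proof. by split; [exact: measurable_cst|exact: integr_cst]. Qed.

Lemma sq_integrM f g : sq_integr f -> sq_integr g -> integr (fun w => f w * g w).
Proof.
move=> [mf fi] [mg gi].
apply: (integr_le (measurable_funM mf mg) (integrD fi gi)) => w.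
have h1 := sqr_ge0 (f w - g w); have h2 := sqr_ge0 (f w + g w).
have h3 := sqr_ge0 (f w); have h4 := sqr_ge0 (g w).
by rewrite /= ler_norml; apply/andP; split; lra.
Qed.

Lemma sq_integr_integr f : sq_integr f -> integr f.
Proof.
move=> fs; have := sq_integrM fs (sq_integr_cst 1).
by under eq_fun do rewrite mulr1.
Qed.

Section vectors.
Variables (V : normedModType R) (ip : {dot V for idfun}).
Hypothesis normE : forall v : V, `|v| = Num.sqrt (ip v v).
Hypothesis fdimV : finite_dimensional V.
Implicit Types Z : T -> V.

Definition vsq_integr Z := borel_fun Z /\ sq_integr (fun w => `|Z w|).

Lemma vsq_integrD Z1 Z2 : vsq_integr Z1 -> vsq_integr Z2 ->
  vsq_integr (fun w => Z1 w + Z2 w).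
Proof.
move=> [m1 s1] [m2 s2]; have m12 := borel_funD normE fdimV m1 m2; split => //.
apply: sq_integr_le (borel_fun_norm m12) (sq_integrD s1 s2) _ => w.
by rewrite normr_id ger0_norm ?addr_ge0// ler_normD.
Qed.

Lemma vsq_integrN Z : vsq_integr Z -> vsq_integr (fun w => - Z w).
Proof.
move=> [m s]; split; first exact: (borel_funN normE fdimV).
by under eq_fun do rewrite normrN.
Qed.

Lemma vsq_integrB Z1 Z2 : vsq_integr Z1 -> vsq_integr Z2 ->
  vsq_integr (fun w => Z1 w - Z2 w).
Proof. by move=> s1 s2; apply: vsq_integrD => //; exact: vsq_integrN. Qed.

Lemma vsq_integrZ (c : R) Z : vsq_integr Z -> vsq_integr (fun w => c *: Z w).
Proof.
move=> [m s]; split; first exact: (borel_funZ normE fdimV (measurable_cst c)).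
by under eq_fun do rewrite normrZ; exact: sq_integrZ.
Qed.

Lemma vsq_integr_cst (c : V) : vsq_integr (fun=> c).
Proof. by split; [exact: measurable_cst|exact: sq_integr_cst]. Qed.

Lemma vsq_integr_sum (I : Type) (r : seq I) (Z : I -> T -> V) :
  (forall i, vsq_integr (Z i)) -> vsq_integr (fun w => \sum_(i <- r) Z i w).
Proof.
move=> Zi; elim: r => [|i r ih].
  by under eq_fun do rewrite big_nil; exact: vsq_integr_cst.
by under eq_fun do rewrite big_cons; exact: vsq_integrD.
Qed.

(** For the terms [(W t i + h i (y t)) *: g t i] of the step, whose second factor is
    bounded almost surely. *)
Lemma vsq_integr_scale (a : T -> R) Z (C : R) : sq_integr a -> borel_fun Z ->
  {ae P, forall w, `|Z w| <= C} -> vsq_integr (fun w => a w *: Z w).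
Proof.
move=> sa mZ ZC; have maZ := borel_funZ normE fdimV sa.1 mZ; split => //.
apply: sq_integr_ae_le (borel_fun_norm maZ) (sq_integrZ C sa) _.
apply: filterS ZC => w ZC; rewrite normr_id normrZ normrM mulrC.
by rewrite ler_wpM2r// (le_trans ZC)// ler_norm.
Qed.

Lemma vsq_integr_ip Z1 Z2 : vsq_integr Z1 -> vsq_integr Z2 ->
  integr (fun w => ip (Z1 w) (Z2 w)).
Proof.
move=> [m1 s1] [m2 s2].
apply: (integr_le (borel_fun_ip2 normE fdimV m1 m2) (sq_integrM s1 s2)) => w.
exact: ip_cs_abs.
Qed.

Lemma vsq_integr_norm_le Z (g : T -> R) : borel_fun Z -> sq_integr g ->
  (forall w, `|Z w| <= `|g w|) -> vsq_integr Z.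
Proof.
move=> mZ gs Zg; split => //; apply: (sq_integr_le (borel_fun_norm mZ) gs) => w.
by rewrite normr_id.
Qed.

End vectors.
End integrability.

(** * The subgradient oracle *)

Section kernel_prob.
Context (R : realType) (d1 d2 : measure_display) (E : measurableType d1)
  (O : measurableType d2) (k : R.-pker E ~> O).

(** The same measure as [k x], seen as a probability, to which the results on
    integrable functions apply. *)
Definition kernel_prob (x : E) : set O -> \bar R := k x.

HB.instance Definition _ x := Measure.on (kernel_prob x).
HB.instance Definition _ x := Measure_isProbability.Build _ _ _ (kernel_prob x)
  (prob_kernel x).

End kernel_prob.

Section oracle.
Variables (R : realType) (V : normedModType R) (ip : {dot V for idfun}).
Hypothesis normE : forall v : V, `|v| = Num.sqrt (ip v v).
Hypothesis fdimV : finite_dimensional V.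

(** Jensen's inequality in the weak sense: [`|e| ^+ 2] is the mean of [ip (Z o) e],
    which is at most [(b o + `|e| ^+ 2) / 2]. *)
Lemma vector_mean_norm_le (d : measure_display) (S : measurableType d)
    (P : probability S R) (Z : S -> V) (e : V) (b : S -> R) (C : R) :
  is_vector_mean ip P Z e -> 0 <= C -> integr P b ->
  {ae P, forall o, `|Z o| ^+ 2 <= b o} ->
  (\int[P]_o (b o)%:E <= (C ^+ 2)%:E)%E -> `|e| <= C.
Proof.
move=> /(_ e) [Zi ZE] C0 bi Zb bC.
have := integral_ae_le (f := fun o => ip (Z o) e)
  (g := fun o => 2^-1 * (b o + `|e| ^+ 2)) Zi.
have be := integrD bi (integr_cst P (`|e| ^+ 2)).
move=> /(_ (integrZ _ be)) H.
have {H} : (\int[P]_o (ip (Z o) e)%:E <=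
    \int[P]_o (2^-1 * (b o + `|e| ^+ 2))%:E)%E.
  apply: H; apply: filterS Zb => o Zb.
  have h1 := ip_cs normE (Z o) e; have h2 := sqr_ge0 (`|Z o| - `|e|).
  lra.
rewrite ZE; under eq_integral do rewrite EFinM.
rewrite (integralZl measurableT be) /=.
under eq_integral do rewrite EFinD.
rewrite (integralD_EFin measurableT bi (integr_cst P _)) integral_cst; last by [].
rewrite [X in (_ * (_ + _ * X))%E](@probability_setT _ _ _ P) mule1 => h.
have := le_trans h (lee_wpmul2l _ (leeD2r _ bC)).
rewrite lee_fin invr_ge0 ler0n => /(_ isT).
rewrite -EFinD -EFinM lee_fin -(normV2 normE) => {}h.
by rewrite -(@ler_pXn2r _ 2%N)// ?nnegrE//; lra.
Qed.

Variables (m : nat) (f : V -> R) (h : 'I_m -> V -> R) (Y : set V).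
Variables (L : R) (Gi : 'I_m -> R).
Local Notation answer := (borel V * m.-tuple (borel V))%type.
Variable k : R.-pker borel V ~> answer.
Hypotheses (L0 : 0 <= L) (Gi0 : forall i, 0 <= Gi i).
Hypothesis oracle : is_subgradient_oracle ip f h Y L Gi k.

Lemma borel_answer1 : borel_fun (fun o : answer => o.1 : V).
Proof. exact: measurable_fst. Qed.

Lemma borel_answer2 i : borel_fun (fun o : answer => tnth o.2 i : V).
Proof. exact: measurableT_comp (measurable_tnth i) measurable_snd. Qed.

Lemma answer1_sq y : Y y -> (\int[k y]_o (`|o.1 : V| ^+ 2)%:E <= (L ^+ 2)%:E)%E.
Proof.
move=> /oracle[_ _ _]; set I := (\int[k y]_o _)%E.
have I0 : (0 <= I)%E by apply: integral_ge0 => o _; rewrite lee_fin sqr_ge0.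
case: I I0 => [r| |]//=; rewrite ?lee_fin ?leye_eq//.
by move=> r0 rL; rewrite -(sqr_sqrtr r0) lerXn2r ?nnegrE.
Qed.

Lemma oracle_subgradient : bounded_subgradient ip Y L f.
Proof.
move=> y Yy; have [[e eE esub] _ _ _] := oracle Yy; exists e => //.
have mb : measurable_fun setT (fun o : answer => `|o.1 : V| ^+ 2).
  by apply: measurable_funX; exact: (borel_fun_norm borel_answer1).
apply: (@vector_mean_norm_le _ _ (kernel_prob k y) _ _
  (fun o => `|o.1 : V| ^+ 2) _ eE) => //.
- apply/integrableP; split; first exact/measurable_EFinP.
  apply: le_lt_trans (ltry (L ^+ 2)); apply: le_trans (answer1_sq Yy).
  apply: ge0_le_integral => //.
  + apply: measurableT_comp => //; exact/measurable_EFinP.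
  + exact/measurable_EFinP.
  + by move=> o _; rewrite /= lee_fin ger0_norm// sqr_ge0.
- exact: aeW.
- exact: answer1_sq.
Qed.

Lemma oracle_constraint_subgradient i : bounded_subgradient ip Y (Gi i) (h i).
Proof.
move=> y Yy; have [_ /(_ i)[e eE esub] /(_ i) gG _] := oracle Yy; exists e => //.
apply: (@vector_mean_norm_le _ _ (kernel_prob k y) _ _
  (fun o => Gi i ^+ 2) _ eE) => //.
- exact: integr_cst.
- apply: (@filterS _ _ (ae_filter_ringOfSetsType (kernel_prob k y)) _ _ _ gG).
  by move=> o oG; rewrite lerXn2r ?nnegrE.
rewrite integral_cst; last by [].
by rewrite [X in (_ * X)%E](@probability_setT _ _ _ (kernel_prob k y)) mule1.
Qed.

End oracle.

(** * Random runs of the algorithm *)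

Section weights_measurable.
Variables (R : realType) (V : normedModType R) (ip : {dot V for idfun}).
Hypothesis normE : forall v : V, `|v| = Num.sqrt (ip v v).
Hypothesis fdimV : finite_dimensional V.
Variables (m : nat) (h : 'I_m -> V -> R).
Hypothesis conth : forall i, continuous (h i).
Context (d : measure_display) (O : measurableType d).

Lemma measurable_pospart (a : O -> R) : measurable_fun setT a ->
  measurable_fun setT (fun w => pospart (a w)).
Proof. by move=> ma; apply: measurable_maxr => //; exact: measurable_cst. Qed.

(** Over an arbitrary space, because it serves twice: for the sigma-algebra of the
    underlying probability space, and for that of the past, where it shows that the
    weights are known before the oracle is called. *)
Lemma measurable_weights (y : nat -> O -> V) (g : nat -> O -> m.-tuple V)
    (W : nat -> O -> 'I_m -> R) (n : nat) :
  (forall w i, W 1%N w i = pospart (- h i (y 1%N w))) ->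
  (forall t w i, (0 < t < n)%N -> W t.+1 w i =
      Num.max (W t w i + h i (y t w) + ip (tnth (g t w) i) (y t.+1 w - y t w))
              (pospart (- h i (y t.+1 w)))) ->
  (forall t, (0 < t <= n)%N -> borel_fun (y t)) ->
  (forall t i, (0 < t < n)%N -> borel_fun (fun w => tnth (g t w) i)) ->
  (0 < n)%N -> forall i, measurable_fun setT (fun w => W n w i).
Proof.
move=> W1 WS my mg n0 i.
have mh t : (0 < t <= n)%N -> measurable_fun setT (fun w => h i (y t w)).
  by move=> tn; exact: borel_fun_comp (@conth i) (my _ tn).
have mph t : (0 < t <= n)%N ->
    measurable_fun setT (fun w => pospart (- h i (y t w))).
  by move=> tn; apply: measurable_pospart; apply: measurable_funN; exact: mh.
have {n0} : (0 < n <= n)%N by rewrite n0 leqnn.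
elim: {1 2 4}n => // -[_ tn|t ih tn].
  by under eq_fun do rewrite W1; exact: mph.
have tn' : (0 < t.+1 < n)%N by [].
have tn'' : (0 < t.+1 <= n)%N by exact: ltnW.
under eq_fun do rewrite (WS _ _ _ tn').
apply: measurable_maxr; last exact: mph.
apply: measurable_funD; first by apply: measurable_funD; [exact: ih|exact: mh].
apply: (borel_fun_ip2 normE fdimV); first exact: mg.
by apply: (borel_funB normE fdimV); exact: my.
Qed.

End weights_measurable.

Section run.
Variables (R : realType) (V : normedModType R) (ip : {dot V for idfun}).
Variables (m : nat) (f : V -> R) (h : 'I_m -> V -> R) (X Y : set V).
Variables (D delta L G : R) (Gi : 'I_m -> R).
Variable K : nat -> R.-pker borel V ~> (borel V * m.-tuple (borel V))%type.
Variables (x1 z : V).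
Hypotheses (normE : forall v : V, `|v| = Num.sqrt (ip v v))
  (fdimV : finite_dimensional V)
  (contf : continuous f) (conth : forall i, continuous (h i))
  (diamX : forall x y, X x -> X y -> `|x - y| <= D)
  (convY : convex_set Y) (subXY : X `<=` Y)
  (L0 : 0 <= L) (Gi0 : forall i, 0 <= Gi i)
  (oracleK : forall t, is_subgradient_oracle ip f h Y L Gi (K t))
  (Xx1 : X x1) (Xz : X z) (hz : forall i, h i z <= 0).
Variables (eta alpha beta : R) (T : nat).
Hypotheses (eta0 : 0 < eta) (alpha0 : 0 < alpha) (beta0 : 0 < beta).
Context (d : measure_display) (Omega : measurableType d).
Variables (P : probability Omega R) (x y Q s : nat -> Omega -> V).
Variables (W : nat -> Omega -> 'I_m -> R) (g : nat -> Omega -> m.-tuple V).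
Hypothesis run :
  algorithm_run ip h X Y G x1 K delta eta alpha beta T P x y Q s W g.

Let gam := alpha + 2 * G ^+ 2 * beta.
Local Notation answer := (borel V * m.-tuple (borel V))%type.

Let subf : bounded_subgradient ip Y L f := oracle_subgradient normE L0 (oracleK 0).
Let subh i : bounded_subgradient ip Y (Gi i) (h i) :=
  @oracle_constraint_subgradient _ _ _ normE _ _ _ _ _ _ _ Gi0 (oracleK 0) i.

Lemma run_Xx t w : (0 < t <= T)%N -> X (x t w).
Proof.
case: t => // -[|t] tT; first by rewrite (run_x1 run).
by have [] := run_x run (tT : (0 < t.+1 < T)%N).
Qed.

Lemma run_Yy t w : (0 < t <= T)%N -> Y (y t w).
Proof.
case: t => // -[|t] tT; first by rewrite (run_y1 run); exact: subXY.
by have [] := run_y run w (tT : (0 < t.+1 < T)%N).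
Qed.

Lemma measurable_x t : (0 < t <= T)%N -> borel_fun (x t).
Proof.
case: t => // -[|t] tT.
  by rewrite (_ : x 1%N = fun=> x1); [exact: borel_fun_cst|exact/funext/(run_x1 run)].
by have [] := run_x run (tT : (0 < t.+1 < T)%N).
Qed.

Lemma measurable_s t : (0 < t <= T)%N -> borel_fun (s t).
Proof. by move=> /(run_sgrad run)[+ _] => /measurable_fun_pairP[]. Qed.

Lemma measurable_g t i : (0 < t <= T)%N -> borel_fun (fun w => tnth (g t w) i).
Proof.
move=> /(run_sgrad run)[+ _] => /measurable_fun_pairP[_ mg].
exact: measurableT_comp (measurable_tnth i) mg.
Qed.

(** The points and the queue have to be treated together, as each step uses both;
    the projected point is measurable because the projection is nonexpansive. *)
Lemma measurable_yQ n : (0 < n <= T)%N ->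
  (forall t, (0 < t <= n)%N -> borel_fun (y t)) /\ borel_fun (Q n).
Proof.
elim: n => // -[_ _|n ih nT].
  split=> [[|[|t]] // _|].
    by rewrite (_ : y 1%N = fun=> x1); [exact: borel_fun_cst|exact/funext/(run_y1 run)].
  by rewrite (_ : Q 1%N = fun=> 0); [exact: borel_fun_cst|exact/funext/(run_Q1 run)].
have nT' : (0 < n.+1 < T)%N by [].
have nT'' : (0 < n.+1 <= T)%N by exact: ltnW.
have [my mQ] := ih nT''.
have mW i : measurable_fun setT (fun w => W n.+1 w i).
  apply: (measurable_weights normE fdimV conth (run_W1 run) _ my) => //.
    by move=> t w j /andP[t0 tn]; apply: run_W run _ _ _ _; rewrite t0 (ltn_trans tn).
  by move=> t j /andP[t0 tn]; apply: measurable_g; rewrite t0 ltnW// (ltn_trans tn).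
have myn : borel_fun (y n.+1) by apply: my; rewrite leqnn.
have myS : borel_fun (y n.+2).
  apply: (@borel_fun_nonexpansive _ _ _ _
    (y_tilde h G eta alpha beta x y Q s W g n.+1)); last first.
    move=> w w'; apply: (projection_nonexpansive normE convY);
      exact: (run_y run).
  rewrite /y_tilde /p_step; apply: (borel_funZ normE fdimV (measurable_cst _)).
  apply: (borel_funB normE fdimV).
    apply: (borel_funD normE fdimV);
      apply: (borel_funZ normE fdimV (measurable_cst _)) => //.
    exact: measurable_x.
  apply: (borel_funD normE fdimV).
    apply: (borel_funD normE fdimV); last exact: measurable_s.
    exact: (borel_funZ normE fdimV (measurable_cst _)).
  apply: (borel_funZ normE fdimV (measurable_cst _)).
  apply: (borel_fun_sum normE fdimV) => i; apply: (borel_funZ normE fdimV).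
    apply: measurable_funD; first exact: mW.
    exact: borel_fun_comp (@conth i) myn.
  exact: measurable_g.
split=> [t /andP[t0]|].
  by rewrite leq_eqVlt => /predU1P[->//|tn]; apply: my; rewrite t0.
rewrite (_ : Q n.+2 = fun w => Q n.+1 w + y n.+2 w - x n.+2 w); last first.
  by apply/funext => w; rewrite (run_Q run).
apply: (borel_funB normE fdimV); last exact: measurable_x.
exact: (borel_funD normE fdimV).
Qed.

Lemma measurable_y t : (0 < t <= T)%N -> borel_fun (y t).
Proof.
by move=> tT; apply: (measurable_yQ tT).1; case/andP: tT => ->; rewrite leqnn.
Qed.

Lemma measurable_W t i : (0 < t <= T)%N -> measurable_fun setT (fun w => W t w i).
Proof.
move=> /andP[t0 tT].
apply: (measurable_weights normE fdimV conth (run_W1 run)) => //.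
- move=> k w j /andP[k0 kt]; apply: run_W run _ _ _ _.
  by rewrite k0 (leq_trans kt).
- by move=> k /andP[k0 kt]; apply: measurable_y; rewrite k0 (leq_trans kt).
- move=> k j /andP[k0 kt]; apply: measurable_g.
  by rewrite k0 ltnW// (leq_trans kt).
Qed.

Definition history_generators t : set (set Omega) :=
  \bigcup_(k in [set k | (0 < k <= t)%N])
        (generated_by (x k : Omega -> borel V) `|`
         generated_by (y k : Omega -> borel V)) `|`
      \bigcup_(k in [set k | (0 < k < t)%N]) generated_by (sgrad s g k).

(** The underlying space with the sigma-algebra of the history, so that being a
    function of the past becomes measurability. *)
Definition past t := g_sigma_algebraType (history_generators t).

Definition to_past t : Omega -> past t := id.

Lemma past_y t k : (0 < k <= t)%N -> borel_fun (y k : past t -> V).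
Proof.
move=> kt _ B mB; apply: sub_sigma_algebra; left; exists k => //; right.
by exists B.
Qed.

Lemma past_sgrad t k : (0 < k < t)%N ->
  measurable_fun setT (sgrad s g k : past t -> answer).
Proof.
by move=> kt _ B mB; apply: sub_sigma_algebra; right; exists k => //; exists B.
Qed.

Lemma past_g t k i : (0 < k < t)%N ->
  borel_fun ((fun w => tnth (g k w) i) : past t -> V).
Proof.
move=> /past_sgrad/measurable_fun_pairP[_ mg].
exact: measurableT_comp (measurable_tnth i) mg.
Qed.

Lemma past_W t i : (0 < t <= T)%N ->
  measurable_fun setT ((fun w => W t w i) : past t -> R).
Proof.
move=> /andP[t0 tT].
apply: (measurable_weights normE fdimV conth (O := past t) (run_W1 run)) => //.
- move=> k w j /andP[k0 kt]; apply: run_W run _ _ _ _.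
  by rewrite k0 (leq_trans kt).
- by move=> k kt; exact: past_y.
- by move=> k j kt; exact: past_g.
Qed.

Lemma measurable_to_past t : (0 < t <= T)%N -> measurable_fun setT (to_past t).
Proof.
move=> /andP[t0 tT] _ A mA; rewrite setTI.
suff : history_generators t `<=` measurable.
  move=> sub; apply: (smallest_sub _ sub mA).
  exact: sigma_algebra_measurable.
move=> B [|] [k /= /andP[k0 kt]].
  have kT : (0 < k <= T)%N by rewrite k0 (leq_trans kt).
  by case=> -[C mC <-]; [exact: measurable_x|exact: measurable_y].
have kT : (0 < k <= T)%N by rewrite k0 ltnW// (leq_trans kt).
by case=> C mC <-; exact: (run_sgrad run kT).1.
Qed.

(** The hypothesis of [disintegration], with the past as conditioning variable. *)
Lemma sgrad_law t (A : set (past t)) (B : set answer) : (0 < t <= T)%N ->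
  measurable A -> measurable B ->
  P (to_past t @^-1` A `&` sgrad s g t @^-1` B)
    = (\int[P]_(w in to_past t @^-1` A) K t (y t w) B)%E.
Proof.
move=> tT mA mB; have [mZ /(_ B mB)[_ _ _ /(_ A mA)]] := run_sgrad run tT.
have mA' : measurable (to_past t @^-1` A).
  by rewrite -[X in measurable X]setTI; exact: measurable_to_past.
have mB' : measurable (sgrad s g t @^-1` B).
  by rewrite -[X in measurable X]setTI; exact: mZ.
rewrite integral_indic// setIC => ->; apply: eq_integral => w _.
rewrite fineK// ge0_fin_numE//.
by rewrite (le_lt_trans (probability_le1 (kernel_prob (K t) (y t w)) mB))// ltry.
Qed.

Lemma answer_sq t : (0 < t <= T)%N ->
  (\int[P]_w (`|s t w| ^+ 2)%:E <= (L ^+ 2)%:E)%E.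
Proof.
move=> tT; have tt : (0 < t <= t)%N by case/andP: tT => ->; rewrite leqnn.
have mZ := (run_sgrad run tT).1.
apply: (@conditional_integral_le _ _ _ _ _ _ _ (past t) _ P (K t) (y t)
  (to_past t) (sgrad s g t) (past_y tt) (measurable_to_past tT) mZ _
  (fun wo => (`|wo.2.1 : V| ^+ 2)%:E)).
- by move=> A B mA mB; exact: sgrad_law.
- apply/measurable_EFinP; apply: measurable_funX; apply: borel_fun_norm.
  exact: measurableT_comp measurable_fst measurable_snd.
- by move=> wo; rewrite lee_fin sqr_ge0.
- by move=> w; apply: (answer1_sq L0 (oracleK t)); exact: run_Yy.
Qed.

(** The bound holds outside a null set of each conditional law, hence almost
    surely. *)
Lemma answer_norm_le t i : (0 < t <= T)%N ->
  {ae P, forall w, `|tnth (g t w) i| <= Gi i}.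
Proof.
move=> tT; pose B : set answer := [set o | ~~ (`|tnth o.2 i : V| <= Gi i)].
have mB : measurable B.
  have : measurable_fun setT (fun o : answer => `|tnth o.2 i : V| <= Gi i).
    by apply: measurable_fun_ler => //; exact: (borel_fun_norm (borel_answer2 i)).
  move=> /(_ measurableT [set false] I); rewrite setTI; congr measurable.
  by apply/seteqP; split => o; rewrite /B /=; case: (_ <= _).
have mZ := (run_sgrad run tT).1.
exists (sgrad s g t @^-1` B); split.
- by rewrite -[X in measurable X]setTI; exact: mZ.
- have := sgrad_law tT measurableT mB; rewrite preimage_setT setTI => ->.
  rewrite integral0_eq// => w _; apply/eqP; rewrite eq_le measure_ge0 andbT.
  have [_ _ /(_ i)[N [mN N0 sN]] _] := oracleK t (run_Yy w tT).
  rewrite -N0; apply: le_measure; rewrite ?inE// => o /= /negP Bo.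
  by apply: sN.
- by move=> w /= /negP.
Qed.

Lemma lip_norm_le (phi : V -> R) (C : R) u : bounded_subgradient ip Y C phi ->
  Y u -> `|phi u| <= `|phi z| + C * `|u - z|.
Proof.
move=> sub Yu; have := bounded_subgradient_lip normE z sub Yu.
have := bounded_subgradient_lip normE u sub (subXY Xz); rewrite (distrC z).
have := ler_norm (phi z); have := ler_norm (- phi z); rewrite normrN.
by rewrite ler_norml => *; apply/andP; split; lra.
Qed.

Lemma sq_integr_norm (a : Omega -> R) :
  sq_integr P a -> sq_integr P (fun w => `|a w|).
Proof.
move=> sa; apply: (sq_integr_le _ sa) => [|w]; last by rewrite normr_id.
exact: measurableT_comp sa.1.
Qed.

Lemma sq_integr_phi (phi : V -> R) (C : R) t : continuous phi -> 0 <= C ->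
  bounded_subgradient ip Y C phi -> (0 < t <= T)%N -> vsq_integr P (y t) ->
  sq_integr P (fun w => phi (y t w)).
Proof.
move=> cphi C0 sub tT ys.
have yz := vsq_integrB normE fdimV ys (vsq_integr_cst P z).
apply: (sq_integr_le (borel_fun_comp cphi ys.1)
  (sq_integrD (sq_integr_cst P `|phi z|) (sq_integrZ C yz.2))) => w.
rewrite [leRHS]ger0_norm ?addr_ge0 ?mulr_ge0//.
by apply: lip_norm_le => //; exact: run_Yy.
Qed.

Lemma vsq_x t : (0 < t <= T)%N -> vsq_integr P (x t).
Proof.
move=> tT; apply: (vsq_integr_norm_le (measurable_x tT) (sq_integr_cst P (`|z| + D))).
move=> w; apply: le_trans (ler_norm _).
rewrite -[x t w](subrK z) addrC (le_trans (ler_normD _ _))// lerD2l.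
by apply: diamX => //; exact: run_Xx.
Qed.

Lemma vsq_s t : (0 < t <= T)%N -> vsq_integr P (s t).
Proof.
move=> tT; have ms := measurable_s tT; split => //.
split; first exact: borel_fun_norm.
have m2 : measurable_fun setT (fun w => `|s t w| ^+ 2).
  by apply: measurable_funX; exact: borel_fun_norm.
apply/integrableP; split; first exact/measurable_EFinP.
apply: le_lt_trans (ltry (L ^+ 2)); apply: le_trans (answer_sq tT).
apply: ge0_le_integral => //.
- apply: measurableT_comp => //; exact/measurable_EFinP.
- exact/measurable_EFinP.
- by move=> w _; rewrite /= lee_fin ger0_norm// sqr_ge0.
Qed.

(** By induction on time.  The distance from [z] to the projected point is at most
    that to the point before projection, as [z] is its own projection, and the latter is
    a combination of square-integrable vectors. *)
Lemma vsq_yQW n : (0 < n <= T)%N -> [/\ vsq_integr P (y n), vsq_integr P (Q n) &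
  forall i, sq_integr P (fun w => W n w i)].
Proof.
elim: n => // -[_ _|n ih nT].
  rewrite (_ : y 1%N = fun=> x1); last exact/funext/(run_y1 run).
  rewrite (_ : Q 1%N = fun=> 0); last exact/funext/(run_Q1 run).
  split=> [||i]; [exact: vsq_integr_cst..|].
  by under eq_fun do rewrite (run_W1 run) (run_y1 run); exact: sq_integr_cst.
have nT' : (0 < n.+1 < T)%N by [].
have nT'' : (0 < n.+1 <= T)%N by exact: ltnW.
have [sy sQ sW] := ih nT''.
have sh i t : (0 < t <= T)%N -> vsq_integr P (y t) ->
    sq_integr P (fun w => h i (y t w)).
  by apply: sq_integr_phi (Gi0 i) (subh i); exact: conth.
have sWh i : sq_integr P (fun w => W n.+1 w i + h i (y n.+1 w)).
  by apply: sq_integrD => //; exact: sh.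
have syt : vsq_integr P (y_tilde h G eta alpha beta x y Q s W g n.+1).
  rewrite /y_tilde /p_step; apply: (vsq_integrZ normE fdimV).
  apply: (vsq_integrB normE fdimV).
    apply: (vsq_integrD normE fdimV); apply: (vsq_integrZ normE fdimV) => //.
    exact: vsq_x.
  apply: (vsq_integrD normE fdimV).
    apply: (vsq_integrD normE fdimV); last exact: vsq_s.
    exact: (vsq_integrZ normE fdimV).
  apply: (vsq_integrZ normE fdimV); apply: (vsq_integr_sum normE fdimV) => i.
  apply: (vsq_integr_scale normE fdimV (C := Gi i)) => //.
    exact: measurable_g.
  exact: answer_norm_le.
have syS : vsq_integr P (y n.+2).
  have sytz := vsq_integrB normE fdimV syt (vsq_integr_cst P z).
  apply: (vsq_integr_norm_le (measurable_y nT)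
    (sq_integrD (sq_integr_cst P `|z|) sytz.2)) => w.
  rewrite [leRHS]ger0_norm ?addr_ge0// -[y n.+2 w](subrK z) addrC.
  rewrite (le_trans (ler_normD _ _))// lerD2l.
  apply: (projection_nonexpansive normE convY (run_y run w nT')).
  by split=> [|u _]; [exact: subXY|rewrite subrr normr0].
split => //.
  rewrite (_ : Q n.+2 = fun w => Q n.+1 w + y n.+2 w - x n.+2 w); last first.
    by apply/funext => w; rewrite (run_Q run).
  apply: (vsq_integrB normE fdimV); last exact: vsq_x.
  exact: (vsq_integrD normE fdimV).
move=> i; have sd := vsq_integrB normE fdimV syS sy.
have smaj := sq_integrD (sq_integrD (sq_integr_norm (sWh i))
  (sq_integrZ (Gi i) sd.2)) (sq_integr_norm (sh i _ nT syS)).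
apply: (sq_integr_ae_le (measurable_W i nT) smaj).
apply: filterS (answer_norm_le i nT'') => w gG; rewrite [leRHS]ger0_norm; last first.
  by rewrite !addr_ge0// mulr_ge0.
rewrite (run_W run _ _ nT'); set d0 := y n.+2 w - y n.+1 w.
have h1 := ler_wpM2r (normr_ge0 d0) gG.
have := ip_cs_abs normE (tnth (g n.+1 w) i) d0; rewrite ler_norml => /andP[h2 h3].
have h4 := ler_norm (W n.+1 w i + h i (y n.+1 w)).
have h5 := ler_norm (- (W n.+1 w i + h i (y n.+1 w))); rewrite normrN in h5.
have h6 := ler_norm (- h i (y n.+2 w)); rewrite normrN in h6.
have h7 := normr_ge0 (h i (y n.+2 w)).
have h8 := mulr_ge0 (Gi0 i) (normr_ge0 d0).
have h9 := pospart_ge0 (- h i (y n.+2 w)).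
have h10 := normr_ge0 (W n.+1 w i + h i (y n.+1 w)).
have h11 : pospart (- h i (y n.+2 w)) <= `|h i (y n.+2 w)|.
  by rewrite /pospart ge_max h7.
by rewrite ler_norml; apply/andP; split; [rewrite le_max|rewrite ge_max];
  [apply/orP; right; lra|apply/andP; split; lra].
Qed.

(** For [y t w] fixed, the mean of [ip o.1 (y t w - z)] is the inner product with a
    subgradient of [f], at least [f (y t w) - f z]. *)
Lemma objective_noise t : (0 < t <= T)%N ->
  nonpos_mean P (fun w => f (y t w) - f z - ip (s t w) (y t w - z)).
Proof.
move=> tT; have tt : (0 < t <= t)%N by case/andP: tT => ->; rewrite leqnn.
have mZ := (run_sgrad run tT).1; have [sy _ _] := vsq_yQW tT.
have fi : integr P (fun w => f (y t w) - f z - ip (s t w) (y t w - z)).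
  apply: integrB.
    apply: integrB; last exact: integr_cst.
    exact: sq_integr_integr (sq_integr_phi contf L0 subf tT sy).
  apply: (vsq_integr_ip normE fdimV (vsq_s tT)).
  exact: (vsq_integrB normE fdimV sy (vsq_integr_cst P z)).
split => //.
pose phi (wo : past t * answer) :=
  f (y t wo.1) - f z - ip (wo.2.1 : V) (y t wo.1 - z).
have my1 : borel_fun (fun wo : past t * answer => y t wo.1).
  exact: measurableT_comp (past_y tt) measurable_fst.
have ms1 : borel_fun (fun wo : past t * answer => wo.2.1 : V).
  exact: measurableT_comp measurable_fst measurable_snd.
have myz : borel_fun (fun wo : past t * answer => y t wo.1 - z).
  exact: (borel_funB normE fdimV my1 (borel_fun_cst _)).
have Kint w : integr (kernel_prob (K t) (y t w))
    (fun o => ip (o.1 : V) (y t w - z)).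
  by have [[e eE _] _ _ _] := oracleK t (run_Yy w tT); exact: (eE _).1.
apply: (@conditional_integral_le0 _ _ _ _ _ _ _ (past t) _ P (K t) (y t)
  (to_past t) (sgrad s g t) (past_y tt) (measurable_to_past tT) mZ _ phi) => //.
- by move=> A B mA mB; exact: sgrad_law.
- apply: measurable_funB; last exact: (borel_fun_ip2 normE fdimV ms1 myz).
  apply: measurable_funB => //; exact: borel_fun_comp contf my1.
- move=> w; exact: (integrB (integr_cst (kernel_prob (K t) (y t w))
    (f (y t w) - f z)) (Kint w)).
- move=> w; have [[e eE esub] _ _ _] := oracleK t (run_Yy w tT).
  rewrite /phi /=; under eq_integral do rewrite EFinB.
  rewrite (integralB_EFin measurableT
    (integr_cst (kernel_prob (K t) (y t w)) _) (Kint w)).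
  rewrite integral_cst; last by [].
  rewrite [X in (_ * X - _)%E](@probability_setT _ _ _ (kernel_prob (K t) (y t w))).
  rewrite mule1 [X in (_ - X)%E](eE _).2 -EFinB lee_fin.
  by have := esub z; rewrite -(opprB (y t w)) ipNr; lra.
Qed.

(** As for the objective, now with a nonnegative weight which is a function of the
    past; the constraint [h i z <= 0] removes the value at [z]. *)
Lemma constraint_noise t i : (0 < t <= T)%N ->
  nonpos_mean P (fun w => (W t w i + h i (y t w)) *
    (h i (y t w) - ip (tnth (g t w) i) (y t w - z))).
Proof.
move=> tT; have tt : (0 < t <= t)%N by case/andP: tT => ->; rewrite leqnn.
have mZ := (run_sgrad run tT).1; have [sy _ sW] := vsq_yQW tT.
have sh := sq_integr_phi (@conth i) (Gi0 i) (subh i) tT sy.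
have sWh := sq_integrD (sW i) sh.
have syz := vsq_integrB normE fdimV sy (vsq_integr_cst P z).
have fi : integr P (fun w => (W t w i + h i (y t w)) *
    (h i (y t w) - ip (tnth (g t w) i) (y t w - z))).
  under eq_fun do rewrite mulrBr -ipZl.
  apply: integrB; first exact: sq_integrM.
  apply: (vsq_integr_ip normE fdimV _ syz).
  exact: (vsq_integr_scale normE fdimV sWh (measurable_g i tT) (answer_norm_le i tT)).
split => //.
pose phi (wo : past t * answer) := (W t wo.1 i + h i (y t wo.1)) *
    (h i (y t wo.1) - ip (tnth wo.2.2 i : V) (y t wo.1 - z)).
have my1 : borel_fun (fun wo : past t * answer => y t wo.1).
  exact: measurableT_comp (past_y tt) measurable_fst.
have mg1 : borel_fun (fun wo : past t * answer => tnth wo.2.2 i : V).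
  exact: measurableT_comp (borel_answer2 i) measurable_snd.
have mW1 : measurable_fun setT (fun wo : past t * answer => W t wo.1 i).
  exact: measurableT_comp (past_W i tT) measurable_fst.
have mh1 : measurable_fun setT (fun wo : past t * answer => h i (y t wo.1)).
  exact: borel_fun_comp (@conth i) my1.
have myz : borel_fun (fun wo : past t * answer => y t wo.1 - z).
  exact: (borel_funB normE fdimV my1 (borel_fun_cst _)).
have Kint w : integr (kernel_prob (K t) (y t w))
    (fun o => ip (tnth o.2 i : V) (y t w - z)).
  by have [_ /(_ i)[e eE _] _ _] := oracleK t (run_Yy w tT); exact: (eE _).1.
have Kint2 w := integrB (integr_cst (kernel_prob (K t) (y t w)) (h i (y t w)))
  (Kint w).
apply: (@conditional_integral_le0 _ _ _ _ _ _ _ (past t) _ P (K t) (y t)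
  (to_past t) (sgrad s g t) (past_y tt) (measurable_to_past tT) mZ _ phi) => //.
- by move=> A B mA mB; exact: sgrad_law.
- apply: measurable_funM; first exact: measurable_funD.
  apply: measurable_funB => //; exact: (borel_fun_ip2 normE fdimV mg1 myz).
- by move=> w; exact: (integrZ (W t w i + h i (y t w)) (Kint2 w)).
- move=> w; have [_ /(_ i)[e eE esub] _ _] := oracleK t (run_Yy w tT).
  have a0 : 0 <= W t w i + h i (y t w).
    have : pospart (- h i (y t w)) <= W t w i.
      case: (t) tT => // -[|t'] t'T; first by rewrite (run_W1 run).
      by rewrite (run_W run)// le_max lexx orbT.
    by have := ge_pospart (- h i (y t w)); lra.
  rewrite /phi /=; under eq_integral do rewrite EFinM.
  rewrite (integralZl measurableT (Kint2 w)) /= mule_ge0_le0//.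
  under eq_integral do rewrite EFinB.
  rewrite (integralB_EFin measurableT
    (integr_cst (kernel_prob (K t) (y t w)) _) (Kint w)).
  rewrite integral_cst; last by [].
  rewrite [X in (_ * X - _)%E](@probability_setT _ _ _ (kernel_prob (K t) (y t w))).
  rewrite mule1 [X in (_ - X)%E](eE _).2 -EFinB lee_fin.
  by have := hz i; have := esub z; rewrite -(opprB (y t w)) ipNr; lra.
Qed.

(** The point [z] is a competitor of the answer to the query [- Q t]. *)
Lemma lmo_noise t : (0 < t < T)%N ->
  nonpos_mean P (fun w => ip (Q t w) (z - x t.+1 w) - delta).
Proof.
move=> tT; have tT' : (0 < t <= T)%N by case/andP: tT => -> /ltnW ->.
have [_ sQ _] := vsq_yQW tT'.
have sx : vsq_integr P (x t.+1) by apply: vsq_x; case/andP: tT => _ ->.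
have iQz := vsq_integr_ip normE fdimV sQ (vsq_integr_cst P z).
have iQx := vsq_integr_ip normE fdimV sQ sx.
have iQ : integr P (fun w => ip (Q t w) (z - x t.+1 w) - delta).
  apply: integrB; last exact: integr_cst.
  by under eq_fun do rewrite ipBr; exact: integrB.
split => //.
have [_ _ [C [Zi Ci _ CE] Cle]] := run_x run tT.
have {}CE := CE setT (ex_intro2 _ _ setT measurableT (setTI _)).
have iB : integr P (fun w => - ip (Q t w) z + delta).
  apply: integrD; last exact: integr_cst.
  by under eq_fun do rewrite -mulN1r; exact: integrZ.
have Cle' : (\int[P]_w (C w)%:E <= \int[P]_w (- ip (Q t w) z + delta)%:E)%E.
  apply: integral_ae_le => //; apply: filterS (Cle z Xz) => w /le_trans; apply.
  by rewrite ipNr ipC.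
rewrite (_ : (fun w => _) = (fun w =>
  ((ip (x t.+1 w) (- Q t w))%:E - (- ip (Q t w) z + delta)%:E)%E)); last first.
  apply/funext => w; rewrite -EFinB; congr EFin.
  by rewrite ipBr ipNr (ipC _ (x _ _)); ring.
rewrite (integralB_EFin measurableT Zi iB) CE.
have fin := integrable_fin_num measurableT iB.
by rewrite leeBlDr// add0e.
Qed.

Lemma sq_noise t : (0 < t <= T)%N ->
  nonpos_mean P (fun w => `|s t w| ^+ 2 - L ^+ 2).
Proof.
move=> tT; have is2 : integr P (fun w => `|s t w| ^+ 2) := (vsq_s tT).2.2.
split; first exact: integrB is2 (integr_cst P _).
under eq_integral do rewrite EFinB.
rewrite (integralB_EFin measurableT is2 (integr_cst P _)) integral_cst; last by [].
rewrite [X in (_ - _ * X)%E](@probability_setT _ _ _ P) mule1.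
by rewrite leeBlDr// add0e; exact: answer_sq.
Qed.

Lemma noise_nonpos_mean t : (0 < t < T)%N -> nonpos_mean P (fun w =>
  run_noise ip f h delta L z eta alpha beta (x ^~ w) (y ^~ w) (Q ^~ w) (s ^~ w)
    (fun t => W t w) (fun t i => tnth (g t w) i) t).
Proof.
move=> tT; have tT' : (0 < t <= T)%N by case/andP: tT => -> /ltnW ->.
rewrite /run_noise /noise; apply: nonpos_meanD; last first.
  under eq_fun do rewrite mulrC.
  by apply: nonpos_meanZ; [rewrite invr_ge0 mulr_ge0// ltW|exact: sq_noise].
apply: nonpos_meanD; last by apply: nonpos_meanZ; [exact: ltW|exact: lmo_noise].
apply: nonpos_meanD; first exact: objective_noise.
apply: nonpos_meanZ; first exact: ltW.
by apply: nonpos_mean_sum => i _; exact: constraint_noise.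
Qed.

End run.

(** * The expected constraint violation *)

Section expected_violation.
Variables (R : realType) (V : normedModType R) (ip : {dot V for idfun}).
Variables (m : nat) (f : V -> R) (h : 'I_m -> V -> R) (X Y : set V).
Variables (D delta L G : R) (Gi mu : 'I_m -> R).
Variable K : nat -> R.-pker borel V ~> (borel V * m.-tuple (borel V))%type.
Variables (x1 z : V).
Hypotheses (normE : forall v : V, `|v| = Num.sqrt (ip v v))
  (fdimV : finite_dimensional V)
  (contf : continuous f) (conth : forall i, continuous (h i))
  (convX : convex_set X)
  (diamX : forall x y, X x -> X y -> `|x - y| <= D)
  (convY : convex_set Y) (subXY : X `<=` Y)
  (delta0 : 0 <= delta) (L0 : 0 <= L) (G0 : 0 <= G) (Gi0 : forall i, 0 <= Gi i)
  (sumG : \sum_(i < m) Gi i ^+ 2 <= G ^+ 2)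
  (oracleK : forall t, is_subgradient_oracle ip f h Y L Gi (K t))
  (Xx1 : X x1) (Xz : X z) (hz : forall i, h i z <= 0)
  (mu0 : forall i, 0 <= mu i)
  (lagr : forall u, X u -> f z <= f u + \sum_(i < m) mu i * h i u).
Variables (eta alpha beta : R) (T : nat).
Hypotheses (eta0 : 0 < eta) (alpha0 : 0 < alpha) (beta0 : 0 < beta) (T0 : (0 < T)%N).
Context (d : measure_display) (Omega : measurableType d).
Variables (P : probability Omega R) (x y Q s : nat -> Omega -> V).
Variables (W : nat -> Omega -> 'I_m -> R) (g : nat -> Omega -> m.-tuple V).
Hypothesis run :
  algorithm_run ip h X Y G x1 K delta eta alpha beta T P x y Q s W g.

Let gam := alpha + 2 * G ^+ 2 * beta.

Let subh i : bounded_subgradient ip Y (Gi i) (h i) :=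
  @oracle_constraint_subgradient _ _ _ normE _ _ _ _ _ _ _ Gi0 (oracleK 0) i.

Let viol w := norm2 (fun i => pospart (h i (x_bar T x w))).

Let total_noise w := \sum_(1 <= t < T)
  run_noise ip f h delta L z eta alpha beta (x ^~ w) (y ^~ w) (Q ^~ w) (s ^~ w)
    (fun t => W t w) (fun t i => tnth (g t w) i) t.

Lemma x_bar_in w : X (x_bar T x w).
Proof. by apply: convex_average => // t tT; exact: (run_Xx Xx1 run). Qed.

Lemma measurable_x_bar : borel_fun (x_bar T x).
Proof.
apply: (borel_funZ normE fdimV (measurable_cst _)).
pose x' t := if (0 < t <= T)%N then x t else fun=> 0.
rewrite (_ : (fun w => _) = fun w => \sum_(1 <= t < T.+1) x' t w); last first.
  by apply/funext => w; apply: eq_big_nat => t tT; rewrite /x' -ltnS tT.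
apply: (borel_fun_sum normE fdimV) => t; rewrite /x'.
by case: ifP => [tT|_]; [exact: (measurable_x run)|exact: borel_fun_cst].
Qed.

(** The violation is bounded, since [h i] is at most [Gi i * D] on [X]. *)
Lemma integr_violation : integr P viol.
Proof.
have D0 : 0 <= D by rewrite (le_trans _ (diamX Xx1 Xx1)).
have mv : measurable_fun setT viol.
  apply: (@measurableT_comp _ _ _ _ _ _ (@Num.sqrt R)).
    by apply: continuous_measurable_fun; exact: sqrt_continuous.
  apply: measurable_sum => i; apply: measurable_funX; apply: measurable_pospart.
  exact: borel_fun_comp (@conth i) measurable_x_bar.
apply: (integr_le mv (integr_cst P (norm2 (fun=> 0 : R) + G * D))) => w.
rewrite ger0_norm ?norm2_ge0//; apply: (norm2_le G0 D0 sumG) => i.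
rewrite pospart_ge0 add0r/= /pospart ge_max mulr_ge0//=.
have := bounded_subgradient_lip normE z (@subh i) (subXY (x_bar_in w)).
have := ler_wpM2l (Gi0 i) (diamX (x_bar_in w) Xz).
have := hz i; lra.
Qed.

Lemma ae_answer_norm_le : {ae P, forall w, forall t i, (0 < t < T)%N ->
  `|tnth (g t w) i| <= Gi i}.
Proof.
have H t n : {ae P, forall w, forall i : 'I_m, i = n :> nat -> (0 < t < T)%N ->
    `|tnth (g t w) i| <= Gi i}.
  have [tT|tT] := boolP (0 < t < T)%N; last exact: aeW.
  have tT' : (0 < t <= T)%N by case/andP: tT => -> /ltnW ->.
  have [nm|nm] := ltnP n m; last first.
    by apply: aeW => w i ni; have := ltn_ord i; rewrite ni ltnNge nm.
  apply: filterS (answer_norm_le normE fdimV conth convY subXY oracleK Xx1 run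
    (Ordinal nm) tT') => w gw i ni _.
  by rewrite (_ : i = Ordinal nm)//; exact: val_inj.
have H2 t := ae_foralln (H t).
have H3 := ae_foralln H2.
by apply: filterS H3 => w gw t i tT; exact: (gw t i i).
Qed.

(** It is enough to bound the violation by an affine function of the noise [Z] for
    all real numbers related as in [trajectory_bound]: the total noise of a run has
    nonpositive mean. *)
Lemma expected_violation_le (b c : R) : 0 <= c ->
  (forall v q w r rho Z,
    0 <= q -> 0 <= w -> 0 <= r -> 0 <= rho ->
    T%:R * v <= w + G * (r + q + rho) ->
    eta / 2 * q ^+ 2 + beta / 2 * w ^+ 2 + gam / 2 * r ^+ 2
      + beta * G ^+ 2 / 2 * (rho ^+ 2 / T%:R)
    <= gam / 2 * D ^+ 2
      + T%:R * (eta * (D ^+ 2 + 2 * delta) / 2 + L ^+ 2 / (2 * alpha))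
      + L * (q + r) + norm2 mu * (w + G * (r + q + rho)) + Z ->
    v <= b + c * Z) ->
  (expected_violation h T P x <= b%:E)%E.
Proof.
move=> c0 bound; rewrite /expected_violation unlock.
have noise_np : nonpos_mean P total_noise.
  apply: nonpos_mean_sum => t; rewrite mem_index_iota => tT.
  exact: (noise_nonpos_mean normE fdimV contf conth diamX convY subXY L0 Gi0
    oracleK Xx1 Xz hz eta0 alpha0 beta0 run tT).
apply: (integral_le_noise integr_violation noise_np c0).
apply: filterS ae_answer_norm_le => w g_leT.
have [] := @trajectory_bound _ _ _ normE _ f h X Y D delta L G Gi mu z
  eta alpha beta T convX convY subXY diamX delta0 G0 Gi0 sumG eta0 alpha0
  beta0 T0 (oracle_subgradient normE L0 (oracleK 0))
  subh
  Xz hz mu0 lagr (x ^~ w) (y ^~ w) (Q ^~ w) (s ^~ w) (fun t => W t w)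
  (fun t i => tnth (g t w) i) (etrans (run_y1 run w) (esym (run_x1 run w)))
  (run_Q1 run w) (run_W1 run w) _ _ _ _ _ _.
- by move=> t tT; exact: (run_Xx Xx1 run).
- by move=> t tT; exact: (run_Yy subXY Xx1 run).
- by move=> t i tT; exact: g_leT.
- by move=> t tT; exact: (run_y run).
- by move=> t tT; exact: (run_Q run).
- by move=> t i tT; exact: (run_W run).
move=> q [v [r [rho [[q0 v0 r0 rho0] hv hP]]]].
exact: (bound _ q v r rho).
Qed.

End expected_violation.

Theorem theorem2 (R : realType) (V : normedModType R) (ip : {dot V for idfun})
    (m : nat) (f : V -> R) (h : 'I_m -> V -> R) (X Y : set V)
    (D delta L G : R) (Gi mu : 'I_m -> R)
    (K : nat -> R.-pker borel V ~> (borel V * m.-tuple (borel V))%type)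
    (x1 xstar : V)
    (fdimV : finite_dimensional V)
    (normE : forall v : V, `|v| = Num.sqrt (ip v v))
    (convf : convex_function setT f) (contf : continuous f)
    (convh : forall i, convex_function setT (h i))
    (conth : forall i, continuous (h i))
    (compX : compact X) (convX : convex_set X)
    (diamX : forall x y, X x -> X y -> `|x - y| <= D)
    (closY : closed Y) (convY : convex_set Y) (subXY : X `<=` Y)
    (hmu : lagrange_multiplier f h X mu)
    (delta0 : 0 <= delta) (L0 : 0 <= L) (G0 : 0 <= G)
    (Gi0 : forall i, 0 <= Gi i) (sumG : \sum_(i < m) Gi i ^+ 2 <= G ^+ 2)
    (oracleK : forall t, is_subgradient_oracle ip f h Y L Gi (K t))
    (Xx1 : X x1) (optx : optimal_solutions f h X xstar) :
  (exists C : R, forall (eps : R) (T : nat),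
     0 < eps -> 1 / eps ^+ 2 <= T%:R ->
     forall (d : measure_display) (Omega : measurableType d)
       (P : probability Omega R) (x y Q s : nat -> Omega -> V)
       (W : nat -> Omega -> 'I_m -> R) (g : nat -> Omega -> m.-tuple V),
     algorithm_run ip h X Y G x1 K delta eps (1 / eps) (1 / eps) T
       P x y Q s W g ->
     (expected_violation h T P x <= (C * eps)%:E)%E)
  /\
  (0 < L -> 0 < G -> 0 < D -> forall T : nat, (0 < T)%N ->
     forall (d : measure_display) (Omega : measurableType d)
       (P : probability Omega R) (x y Q s : nat -> Omega -> V)
       (W : nat -> Omega -> 'I_m -> R) (g : nat -> Omega -> m.-tuple V),
     algorithm_run ip h X Y G x1 K delta
       (L / Num.sqrt (T%:R * (D ^+ 2 + 2 * delta)))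
       (L * Num.sqrt T%:R / D)
       (Num.sqrt T%:R / (G * D)) T
       P x y Q s W g ->
     (expected_violation h T P x <=
      ((Num.sqrt T%:R)^-1 *
       Num.sqrt (coefA0 L G D delta (norm2 (fun i => h i xstar))
                 + coefA1 L G D delta * norm2 mu
                 + coefA2 L G D delta * norm2 mu ^+ 2))%:E)%E).
Proof.
have [[Xz hz] fmin] := optx.
have [mu0 lag] := hmu.
have fopt : f xstar <= optimal_value f h X.
  apply: lb_le_inf; first by exists (f xstar), xstar.
  by move=> _ [u ufeas <-]; exact: fmin.
have lagr u : X u -> f xstar <= f u + \sum_(i < m) mu i * h i u.
  by move=> Xu; exact: le_trans fopt (lag u Xu).
have M0 : 0 <= norm2 mu by exact: norm2_ge0.
split.
  pose A := D ^+ 2 + 2 * delta.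
  pose B2 := 8 * (1 + G ^+ 2) * (A / 2 + (1 + 2 * G ^+ 2) * D ^+ 2 / 2
    + L ^+ 2 / 2 + 4 * L ^+ 2 + 4 * (1 + G ^+ 2) * norm2 mu ^+ 2).
  have B20 : 0 <= B2.
    have G1 : 0 <= 1 + G ^+ 2 by rewrite addr_ge0// sqr_ge0.
    have G2 : 0 <= 1 + 2 * G ^+ 2 by rewrite addr_ge0// mulr_ge0// sqr_ge0.
    have L2 := sqr_ge0 L; have D2 := sqr_ge0 D.
    have := mulr_ge0 G2 D2; have := mulr_ge0 G1 (sqr_ge0 (norm2 mu)).
    by rewrite /B2 /A => *; apply: mulr_ge0; [exact: mulr_ge0|lra].
  (* A constant [B] with [B2 <= B ^+ 2] that is positive even when [B2] vanishes. *)
  exists (1 + B2) => eps T e0 eT d Omega P x y Q s W g run.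
  have ie0 : 0 < 1 / eps by exact: divr_gt0.
  have T0 : (0 < T)%N.
    by rewrite -(ltr0n R) (lt_le_trans _ eT)// divr_gt0// exprn_gt0.
  have B0 : 0 < 1 + B2 by rewrite ltr_pwDl.
  apply: (expected_violation_le normE fdimV contf conth convX diamX convY subXY
    delta0 L0 G0 Gi0 sumG oracleK Xx1 Xz hz mu0 lagr e0 ie0 ie0 T0 run
    (c := 4 * (1 + G ^+ 2) / ((1 + B2) * T%:R))).
    have G1 : 0 <= 1 + G ^+ 2 by rewrite addr_ge0// sqr_ge0.
    by rewrite divr_ge0 ?mulr_ge0// ltW.
  move=> v q w r rho Z q0 w0 r0 rho0 hv hP; rewrite mulrC.
  apply: (accuracy_bound delta0 L0 G0 M0 e0 eT B0 _ hv hP).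
  by rewrite -/A -/B2; have := sqr_ge0 B2; lra.
move=> Lgt0 Ggt0 Dgt0 T T0 d Omega P x y Q s W g.
have Tge0 : 0 <= T%:R :> R by [].
set n := Num.sqrt T%:R; have nT : T%:R = n ^+ 2 by rewrite sqr_sqrtr.
have n1 : 1 <= n by rewrite -sqrtr1 ler_wsqrtr// ler1n.
have n0 : 0 < n by exact: lt_le_trans n1.
rewrite sqrtrM// -/n.
set S := Num.sqrt (D ^+ 2 + 2 * delta) => run.
have S0 : 0 < S by rewrite sqrtr_gt0 ltr_pwDl ?exprn_gt0// mulr_ge0.
have eta0 : 0 < L / (n * S) by rewrite divr_gt0// mulr_gt0.
have alpha0 : 0 < L * n / D by rewrite divr_gt0// mulr_gt0.
have beta0 : 0 < n / (G * D) by rewrite divr_gt0// mulr_gt0.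
set B := Num.sqrt (coefA0 _ _ _ _ _ + _ + _).
apply: (expected_violation_le normE fdimV contf conth convX diamX convY subXY
  delta0 L0 G0 Gi0 sumG oracleK Xx1 Xz hz mu0 lagr eta0 alpha0 beta0 T0 run
  (c := (5 * G * D + 2 * S * G ^+ 2 / L) / (B * n ^+ 2))).
  have GD0 : 0 <= 5 * G * D by rewrite !mulr_ge0// ltW.
  have SG0 : 0 <= 2 * S * G ^+ 2 / L.
    by rewrite divr_ge0// mulr_ge0 ?sqr_ge0// mulr_ge0// ltW.
  by rewrite divr_ge0// ?addr_ge0// mulr_ge0 ?sqrtr_ge0 ?sqr_ge0.
move=> v q w r rho Z q0 w0 r0 rho0; rewrite nT.
exact: rate_bound.
Qed.
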